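(* Let $(X,r)$ be a finite solution of the Yang--Baxter equation of the form $r(x,y)=(\lambda_x(y),\rho(x))$. If $K$ is a field and $M=M(X,r)$, then $K[M]$ is a right Noetherian PI-algebra of finite Gelfand--Kirillov dimension. If, furthermore, the solution $(X,r)$ is left non-degenerate, then $K[M]$ also is left Noetherian.
   Context: A (set-theoretic) solution of the Yang--Baxter equation is a pair $(X,r)$, where $X$ is a set and $r\colon X\times X\to X\times X$ satisfies $(r\times\mathrm{id})(\mathrm{id}\times r)(r\times\mathrm{id})=(\mathrm{id}\times r)(r\times\mathrm{id})(\mathrm{id}\times r)$ on $X^3$. It is finite if $X$ is finite. Here $r(x,y)=(\lambda_x(y),\rho(x))$, where $\lambda_x\colon X\to X$ ($x\in X$) and $\rho\colon X\to X$ are arbitrary maps, so the second component does not depend on $y$; neither the $\lambda_x$ nor $\rho$ are assumed bijective. The solution is left non-degenerate if every $\lambda_x$ is bijective. The structure monoid is $M(X,r)=\langle X\mid x\circ y=\lambda_x(y)\circ\rho(x),\ x,y\in X\rangle$, and $K[M]$ is its monoid algebra. A PI-algebra is an algebra satisfying a non-trivial polynomial identity. *)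

(* Defs.v *)
From HB Require Import structures.
From Stdlib Require Import Relation_Operators.
From mathcomp Require Import all_boot all_algebra generic_quotient finmap.
From mathcomp.multinomials Require Import monalg.
From mathcomp Require Import boolp classical_sets reals constructive_ereal.
From mathcomp Require Import ereal topology sequences exp.

Set Implicit Arguments.
Unset Strict Implicit.
Unset Printing Implicit Defensive.

Import GRing.Theory.

Local Open Scope ring_scope.
Local Open Scope classical_set_scope.

Section YangBaxter.
Context {X : Type} (r : X * X -> X * X).

Definition act12 (t : X * X * X) : X * X * X :=
  let: (x, y, z) := t in let: (u, v) := r (x, y) in (u, v, z).

Definition act23 (t : X * X * X) : X * X * X :=
  let: (x, y, z) := t in let: (u, v) := r (y, z) in (x, u, v).

Definition yang_baxter : Prop :=
  act12 \o act23 \o act12 =1 act23 \o act12 \o act23.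

Definition left_nondegenerate : Prop :=
  forall x : X, bijective (fun y : X => (r (x, y)).1).

End YangBaxter.

Section StructureMonoid.
Context {X : choiceType} (r : X * X -> X * X).

Variant struct_step : seq X -> seq X -> Prop :=
  StructStep (a b : seq X) (x y : X) :
    struct_step (a ++ [:: x; y] ++ b)
                (a ++ [:: (r (x, y)).1; (r (x, y)).2] ++ b).

(* Steps may occur inside any context, so their equivalence closure is already
   the congruence on the free monoid generated by the defining relations. *)
Definition struct_cong : seq X -> seq X -> Prop :=
  clos_refl_sym_trans (seq X) struct_step.

Definition struct_congb : rel (seq X) := fun u v => `[< struct_cong u v >].

Lemma struct_congb_refl : reflexive struct_congb.
Proof. by move=> u; apply/asboolP; apply: rst_refl. Qed.

Lemma struct_congb_sym : symmetric struct_congb.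
Proof. by move=> u v; apply/asboolP/asboolP; apply: rst_sym. Qed.

Lemma struct_congb_trans : transitive struct_congb.
Proof.
by move=> v u w /asboolP uv /asboolP vw; apply/asboolP; apply: rst_trans vw.
Qed.

Canonical struct_equiv :=
  EquivRel struct_congb struct_congb_refl struct_congb_sym struct_congb_trans.

Definition struct_monoid : Type := {eq_quot struct_equiv}%qT.

HB.instance Definition _ := Choice.on struct_monoid.
HB.instance Definition _ := EqQuotient.on struct_monoid.

Lemma struct_cong_cat u u' v v' :
  struct_cong u u' -> struct_cong v v' -> struct_cong (u ++ v) (u' ++ v').
Proof.
move=> uu' vv'; apply: (@rst_trans _ _ _ (u' ++ v)).
  elim: uu' => {u u'} [_ _ [a b x y]|u|u w _|u w z _ IHuw _ IHwz].
  - rewrite -!catA; exact/rst_step/StructStep.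
  - exact: rst_refl.
  - exact: rst_sym.
  - exact: rst_trans IHuw IHwz.
elim: vv' => {v v'} [_ _ [a b x y]|v|v w _|v w z _ IHvw _ IHwz].
- rewrite !(catA u'); exact/rst_step/StructStep.
- exact: rst_refl.
- exact: rst_sym.
- exact: rst_trans IHvw IHwz.
Qed.

Lemma struct_cong_size u v : struct_cong u v -> size u = size v.
Proof.
by elim=> [_ _ [a b x y]|//|//|? ? ? _ -> _ ->//]; rewrite !size_cat.
Qed.

Definition struct_pi (u : seq X) : struct_monoid := \pi_struct_monoid%qT u.

Lemma struct_piP u v : struct_pi u = struct_pi v <-> struct_cong u v.
Proof.
split=> [|uv]; last by apply/eqP; rewrite /struct_pi piE; apply/asboolP.
by move/eqP; rewrite /struct_pi piE => /asboolP.
Qed.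

Definition struct_one : struct_monoid := struct_pi [::].

Definition struct_mul (p q : struct_monoid) : struct_monoid :=
  struct_pi (repr p ++ repr q).

Lemma struct_repr u : struct_cong (repr (struct_pi u)) u.
Proof. by apply/struct_piP; rewrite /struct_pi reprK. Qed.

Lemma struct_mulE u v :
  struct_mul (struct_pi u) (struct_pi v) = struct_pi (u ++ v).
Proof. by apply/struct_piP/struct_cong_cat; apply: struct_repr. Qed.

Lemma struct_piS (P : struct_monoid -> Prop) :
  (forall u, P (struct_pi u)) -> forall p, P p.
Proof. by move=> h p; rewrite -[p]reprK; apply: h. Qed.

Lemma struct_mulA : associative struct_mul.
Proof.
by elim/struct_piS=> u; elim/struct_piS=> v; elim/struct_piS=> w;
  rewrite !struct_mulE catA.
Qed.

Lemma struct_mul1m : left_id struct_one struct_mul.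
Proof. by elim/struct_piS=> u; rewrite struct_mulE. Qed.

Lemma struct_mulm1 : right_id struct_one struct_mul.
Proof. by elim/struct_piS=> u; rewrite struct_mulE cats0. Qed.

(* Required by the library interface: [1] is the only invertible element.
   It holds because the defining relations preserve length. *)
Lemma struct_unitm p q :
  struct_mul p q = struct_one -> p = struct_one /\ q = struct_one.
Proof.
elim/struct_piS: p => u; elim/struct_piS: q => v.
rewrite struct_mulE => /struct_piP/struct_cong_size.
by case: u v => [|x u] [|y v].
Qed.

HB.instance Definition _ := Choice_isMonomialDef.Build struct_monoid
  struct_mulA struct_mul1m struct_mulm1 struct_unitm.

End StructureMonoid.

(* The library only equips [{malg K[M]}] with the [algType] interface when [M]
   is commutative. *)
Definition monoid_algebra (K : fieldType) (M : monomType) : Type := {malg K[M]}.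

Section MonoidAlgebra.
Context (K : fieldType) (M : monomType).

HB.instance Definition _ := GRing.Lalgebra.on (monoid_algebra K M).

Lemma monoid_algebra_scaleAr (c : K) (f g : monoid_algebra K M) :
  c *: (f * g) = f * (c *: g).
Proof.
apply/malgP=> k.
rewrite mcoeffZ mcoeffMl (mcoeffMlw k (fsubset_refl _) (msuppZ_le c g)).
rewrite mulr_sumr; apply: eq_bigr => k1 _.
rewrite mulr_sumr; apply: eq_bigr => k2 _.
by rewrite mcoeffZ mulrnAr mulrCA.
Qed.

HB.instance Definition _ :=
  GRing.Lalgebra_isAlgebra.Build K (monoid_algebra K M) monoid_algebra_scaleAr.

End MonoidAlgebra.

Section Noetherian.
Context (R : nzRingType).

Definition right_ideal (I : set R) : Prop :=
  [/\ I 0, forall a b, I a -> I b -> I (a + b) & forall a b, I a -> I (a * b)].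

Definition left_ideal (I : set R) : Prop :=
  [/\ I 0, forall a b, I a -> I b -> I (a + b) & forall a b, I b -> I (a * b)].

Definition right_noetherian : Prop :=
  forall I : nat -> set R, (forall n, right_ideal (I n)) ->
    (forall n, I n `<=` I n.+1) ->
    exists N, forall n, (N <= n)%N -> I n = I N.

Definition left_noetherian : Prop :=
  forall I : nat -> set R, (forall n, left_ideal (I n)) ->
    (forall n, I n `<=` I n.+1) ->
    exists N, forall n, (N <= n)%N -> I n = I N.

End Noetherian.

Section PolynomialIdentity.
Context (K : fieldType) (A : algType K).

(* [{malg K[{fmonom 'I_n}]}] is the free associative algebra K<x_1, ..., x_n>;
   a monomial is a word in the indices. *)
Definition nc_eval n (a : 'I_n -> A) (f : {malg K[{fmonom 'I_n}]}) : A :=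
  mmap (fun c : K => c%:A) (fun w : {fmonom 'I_n} => \prod_(i <- w) a i) f.

Definition PI_algebra : Prop :=
  exists (n : nat) (f : {malg K[{fmonom 'I_n}]}),
    f != 0 /\ forall a : 'I_n -> A, nc_eval a f = 0.

End PolynomialIdentity.

Section Dimension.
Context (K : fieldType) (V : lmodType K).

Definition lin_indep (s : seq V) : Prop :=
  forall c : 'I_(size s) -> K,
    \sum_(i < size s) c i *: s`_i = 0 -> forall i, c i = 0.

(* The dimension of the linear span of a finite sequence is the largest size
   of a linearly independent subsequence.  The library's [\dim] needs an
   ambient space of finite dimension. *)
Definition span_dim (s : seq V) : nat :=
  \max_(m : (size s).-tuple bool | `[< lin_indep (mask m s) >])
    size (mask m s).

End Dimension.

Section GelfandKirillov.
Context (R : realType) (K : fieldType) (A : algType K).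

Fixpoint prods (s : seq A) (n : nat) : seq A :=
  if n is n'.+1 then [seq a * b | a <- s, b <- prods s n'] else [:: 1].

Definition prods_upto (s : seq A) (n : nat) : seq A :=
  flatten [seq prods s i | i <- iota 0 n.+1].

(* If [V] is the linear span of [s], then [prods s i] spans V^i, so this is
   dim (V^0 + V^1 + ... + V^n). *)
Definition growth (s : seq A) (n : nat) : nat := span_dim (prods_upto s n).

(* GKdim A = sup_V limsup_n log (growth of V at n) / log n, where V ranges over
   the finite-dimensional subspaces, that is, over the spans of the finite
   sequences [s].  The values at n = 0 and n = 1, where [ln n%:R = 0], do not
   affect the limsup. *)
Definition GKdim : \bar R :=
  ereal_sup
    [set limn_esup (fun n => (ln (growth s n)%:R / ln n%:R)%:E) | s in setT].

End GelfandKirillov.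

(* Main.v *)
(* Write u w = lam_u(w) rho^|w|(u) in M.  Choosing N with rho^N idempotent, M is
   a finite union of sets f S, where S is generated by the words of length N
   over the image of rho^N; these form a finite shelf, b c = (b |> c) b with
   left translations L_b.  A word w over the shelf acts by a product L_w of left
   translations and w c = L_w(c) w.  For p with all L_c^p idempotent, the set of
   the c with L_w L_c^p = L_w increases when w is extended to the right, and a
   letter occurring 2p times in w can be split off as a p-th power at the right
   end of w.  Hence every w is a short word times p-th powers of such letters c.
   For a fixed value of this set these powers act from the right as commuting
   operators, and a relative form of Hilbert's basis theorem gives the right
   Noetherian property; counting exponents bounds the growth.
   From the left, w c^p = L_w(c)^p w makes each layer a finitely generated
   module over a commutative ring commuting with right multiplications, so that
   a standard polynomial vanishes on each layer and a power of it vanishes.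
   If the solution is left non-degenerate, then the p-th powers are central in S
   and can be moved across the finitely many f. *)
Require Import Defs.
From HB Require Import structures.
From Stdlib Require Import Relation_Operators.
From mathcomp Require Import all_boot all_order all_algebra perm finmap.
From mathcomp.multinomials Require Import monalg.
From mathcomp Require Import boolp classical_sets reals constructive_ereal.
From mathcomp Require Import ereal topology sequences exp zify.

Set Implicit Arguments.
Unset Strict Implicit.
Unset Printing Implicit Defensive.

Import Order.TTheory GRing.Theory Num.Theory.

Local Open Scope ring_scope.

(** * Submodules and the ascending chain condition *)

Section Submodules.
Context (K : fieldType) (E : lmodType K) (I : eqType).
Context (th : I -> {linear E -> E}).
Implicit Types (S Q : I -> Prop) (U V W : E -> Prop) (F : seq E) (s : seq I).

(** Subspaces are predicates and [S] selects the operators that must preserve them, so that a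
    subspace stable under all words can also be viewed as a module over a few commuting powers. *)
Definition submod S U : Prop :=
  [/\ U 0, forall a x y, U x -> U y -> U (a *: x + y)
    & forall i x, S i -> U x -> U (th i x)].

Inductive gen S U : E -> Prop :=
| gen_in x : U x -> gen S U x
| gen0 : gen S U 0
| gen_lin a x y : gen S U x -> gen S U y -> gen S U (a *: x + y)
| gen_op i x : S i -> gen S U x -> gen S U (th i x).

Lemma gen_submod S U : submod S (gen S U).
Proof. by split; [apply: gen0 | apply: gen_lin | apply: gen_op]. Qed.

Lemma gen_min S U V : submod S V -> (forall x, U x -> V x) ->
  forall x, gen S U x -> V x.
Proof.
move=> [V0 Vl Vo] UV x; elim=> {x} [x /UV//|//|a x y _ Vx _ Vy|i x Si _ Vx].
  exact: Vl.
exact: Vo.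
Qed.

Lemma submodD S U x y : submod S U -> U x -> U y -> U (x + y).
Proof. by case=> _ Ul _ Ux Uy; rewrite -[x]scale1r; apply: Ul. Qed.

Lemma submodZ S U a x : submod S U -> U x -> U (a *: x).
Proof. by case=> U0 Ul _ Ux; rewrite -[_ *: _]addr0; apply: Ul. Qed.

Lemma submodB S U x y : submod S U -> U x -> U y -> U (x - y).
Proof.
move=> sU Ux Uy; rewrite -scaleN1r; apply: (submodD sU) => //.
exact: (submodZ _ sU).
Qed.

Lemma submod_sum S U (J : Type) (r : seq J) (P : pred J) (G : J -> E) :
  submod S U -> (forall j, P j -> U (G j)) -> U (\sum_(j <- r | P j) G j).
Proof.
move=> sU UG; elim/big_rec: _ => [|j x Pj Ux]; first by case: sU.
by apply: (submodD sU) => //; apply: UG.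
Qed.

Lemma submod_sub S Q U : (forall i, Q i -> S i) -> submod S U -> submod Q U.
Proof. by move=> QS [U0 Ul Uo]; split=> // i x /QS; apply: Uo. Qed.

Lemma gen_mono S Q U V : (forall i, S i -> Q i) -> (forall x, U x -> V x) ->
  forall x, gen S U x -> gen Q V x.
Proof.
move=> SQ UV; apply: gen_min; first exact: submod_sub SQ (gen_submod _ _).
by move=> x /UV; apply: gen_in.
Qed.

Lemma submod_add S U V : submod S U -> submod S V ->
  submod S (fun x => exists2 y, U y & V (x - y)).
Proof.
move=> sU sV; case: (sU) (sV) => [U0 Ul Uo] [V0 Vl Vo]; split.
- by exists 0; rewrite ?subr0.
- move=> a x y [x' Ux Vx] [y' Uy Vy]; exists (a *: x' + y'); first exact: Ul.
  by rewrite opprD addrACA -scalerBr; apply: Vl.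
- move=> i x Si [x' Ux Vx]; exists (th i x'); first exact: Uo.
  by rewrite -linearB; apply: Vo.
Qed.

Lemma submod_cap S U V : submod S U -> submod S V ->
  submod S (fun x => U x /\ V x).
Proof.
move=> [U0 Ul Uo] [V0 Vl Vo]; split=> //.
- by move=> a x y [? ?] [? ?]; split; [apply: Ul | apply: Vl].
- by move=> i x Si [? ?]; split; [apply: Uo | apply: Vo].
Qed.

(** The class [C] is arbitrary, so that the condition applies to the subspaces between two given
    ones; this replaces passing to quotients. *)
Definition acc (C : (E -> Prop) -> Prop) : Prop :=
  forall U : nat -> E -> Prop, (forall n, C (U n)) ->
    (forall n x, U n x -> U n.+1 x) ->
    exists N, forall n x, (N <= n)%N -> U n x -> U N x.

Lemma chain_mono (T : Type) (U : nat -> T -> Prop) :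
  (forall n x, U n x -> U n.+1 x) ->
  forall m n x, (m <= n)%N -> U m x -> U n x.
Proof.
move=> US m n x /subnK <-; elim: (n - m)%N => // k IHk Ux.
by rewrite addSn; apply/US/IHk.
Qed.

Lemma acc_bool (P : nat -> Prop) : (forall n, P n -> P n.+1) ->
  exists N, forall n, (N <= n)%N -> P n -> P N.
Proof.
move=> PS; case: (pselect (exists n, P n)) => [[N PN]|nP]; first by exists N.
by exists 0%N => n _ Pn; case: nP; exists n.
Qed.

Lemma acc_fin (k : nat) (P : nat -> nat -> Prop) :
  (forall j, exists N, forall n, (N <= n)%N -> P j n) ->
  exists N, forall n, (N <= n)%N -> forall j, (j < k)%N -> P j n.
Proof.
move=> PN; elim: k => [|k [N IH]]; first by exists 0%N.
have [N' HN'] := PN k; exists (maxn N N') => n.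
rewrite geq_max => /andP[nN nN'] j.
rewrite ltnS leq_eqVlt => /predU1P[->|]; first exact: HN'.
exact: IH.
Qed.

Lemma gen_nil_cons V f F x : submod (fun=> False) V ->
  gen (fun=> False) (fun y => V y \/ y \in f :: F) x ->
  exists c, gen (fun=> False) (fun y => V y \/ y \in F) (x - c *: f).
Proof.
move=> sV; elim=> {x} [x|||//].
- case=> [Vx|]; first by exists 0; rewrite scale0r subr0; apply: gen_in; left.
  rewrite inE => /predU1P[->|xF].
    by exists 1; rewrite scale1r subrr; apply: gen0.
  by exists 0; rewrite scale0r subr0; apply: gen_in; right.
- by exists 0; rewrite scale0r subr0; apply: gen0.
- move=> a x y _ [c Hc] _ [d Hd]; exists (a * c + d).
  by rewrite scalerDl -scalerA opprD addrACA -scalerBr; apply: gen_lin.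
Qed.

(** Induction on [F]: two nested members coincide once they have the same intersection with the span
    [G] of [V] and the tail, and both or neither meet the coset [f + G]. *)
Lemma acc_finite_dim V F : submod (fun=> False) V ->
  acc (fun U => [/\ submod (fun=> False) U, forall x, V x -> U x
    & forall x, U x -> gen (fun=> False) (fun y => V y \/ y \in F) x]).
Proof.
move=> sV; elim: F => [|f F IH] U HU US.
  exists 0%N => n x _; case: (HU n) => _ _ /[apply].
  by apply: gen_min; case: (HU 0%N) => // sU VU _ y [/VU|].
pose G := gen (fun=> False) (fun y => V y \/ y \in F).
have sG : submod (fun=> False) G by apply: gen_submod.
have mU := chain_mono US.
have [|n x [? ?]|N1 HN1] := IH (fun n x => U n x /\ G x).
- move=> n; case: (HU n) => sU VU _; split; first exact: submod_cap.
  + by move=> x Vx; split; [apply: VU | apply: gen_in; left].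
  + by move=> x [].
- by split=> //; apply: US.
have [|N2 HN2] := @acc_bool (fun n => exists2 u, U n u & G (u - f)).
  by move=> n [u Uu Gu]; exists u => //; apply: US.
exists (maxn N1 N2) => n x nN Ux.
have [sUn _ Un] := HU n; have [sUN _ _] := HU (maxn N1 N2).
have [c Gc] := gen_nil_cons sV (Un _ Ux).
have key y : U n y -> G y -> U (maxn N1 N2) y.
  move=> Uy Gy; apply: (mU N1); first exact: leq_maxl.
  by have [] := HN1 n y (leq_trans (leq_maxl _ _) nN) (conj Uy Gy).
have [c0|c0] := eqVneq c 0.
  by apply: key => //; move: Gc; rewrite c0 scale0r subr0.
have [|u Uu Gu] := HN2 n (leq_trans (leq_maxr _ _) nN).
  exists (c^-1 *: x); first exact: (submodZ _ sUn).
  rewrite -[f](scalerK c0) -scalerBr.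
  exact: (submodZ _ sG).
have UNu : U (maxn N1 N2) u by apply: mU Uu; exact: leq_maxr.
rewrite -[x](subrK (c *: u)); apply: (submodD sUN).
  apply: key; last first.
    have -> : x - c *: u = (x - c *: f) - c *: (u - f).
      by rewrite scalerBr opprB addrA subrK.
    by apply: (submodB sG) => //; apply: (submodZ _ sG).
  by apply: (submodB sUn) => //; apply: (submodZ _ sUn); apply: mU UNu.
exact: (submodZ _ sUN).
Qed.

(** * Adjoining one operator: the relative Hilbert basis argument *)

Section HilbertStep.
Context (i : I) (s : seq I) (V V' : E -> Prop) (F : seq E).
Hypothesis sV : submod (fun j => j \in i :: s) V.
Hypothesis sV' : submod (fun j => j \in i :: s) V'.
Hypothesis V'V : forall x, V' x -> V x.
Hypothesis FV : forall x, x \in F -> V x.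
Hypothesis comm : forall j x, j \in s -> V x ->
  V' (th j (th i x) - th i (th j x)).

Local Notation W := (gen (fun j => j \in s) (fun y => V' y \/ y \in F)).
Local Notation theta k := (iter k (th i)).

Let in_cons j : j \in s -> j \in i :: s.
Proof. by rewrite inE orbC => ->. Qed.

Let sW : submod (fun j => j \in s) W.
Proof. exact: gen_submod. Qed.

Let sV's : submod (fun j => j \in s) V'.
Proof. exact: submod_sub sV'. Qed.

Let WV x : W x -> V x.
Proof.
apply: gen_min; first exact: submod_sub sV.
by move=> y [/V'V|/FV].
Qed.

Let thetaD k a x y : theta k (a *: x + y) = a *: theta k x + theta k y.
Proof. by elim: k => //= k ->; rewrite linearP. Qed.

Let theta_in U k x : (forall y, U y -> U (th i y)) -> U x -> U (theta k x).
Proof. by move=> UP Ux; elim: k => //= k; apply: UP. Qed.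

(** The polynomials of degree below [k] in the operator [th i], with coefficients in [W], up to
    [V']. *)
Fixpoint level k (x : E) : Prop :=
  if k is k'.+1 then exists2 w, W w & level k' (x - theta k' w) else V' x.

Let V'i x : V' x -> V' (th i x).
Proof. by case: sV' => _ _ H; apply: H; apply: mem_head. Qed.

Let Vi x : V x -> V (th i x).
Proof. by case: sV => _ _ H; apply: H; apply: mem_head. Qed.

Let theta_comm k j x : j \in s -> V x ->
  V' (th j (theta k x) - theta k (th j x)).
Proof.
move=> js Vx; elim: k => [|k IHk] /=; first by rewrite subrr; case: sV'.
rewrite -[_ - _](subrKA (th i (th j (theta k x)))) -linearB.
apply: (submodD sV'); last exact: V'i.
by apply: comm => //; apply: theta_in.
Qed.

Let level_V' k x : V' x -> level k x.
Proof.
elim: k x => //= k IHk x V'x; exists 0; first exact: gen0.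
have -> : theta k 0 = 0 by elim: k {IHk} => //= k ->; rewrite linear0.
by rewrite subr0; apply: IHk.
Qed.

Let level_submod k : submod (fun j => j \in s) (level k).
Proof.
elim: k => //= k IHk; split.
- by apply: (level_V' k.+1); case: sV'.
- move=> a x y [w Ww Lx] [z Wz Ly]; exists (a *: w + z); first exact: gen_lin.
  by rewrite thetaD opprD addrACA -scalerBr; case: IHk => _ + _; apply.
- move=> j x js [w Ww Lx]; exists (th j w); first exact: gen_op.
  rewrite -[_ - _](subrKA (th j (theta k w))) -linearB.
  apply: (submodD IHk); first by case: IHk => _ _; apply.
  by apply: level_V'; apply: theta_comm => //; apply: WV.
Qed.

Let level_op k x : level k x -> level k.+1 (th i x).
Proof.
elim: k x => [|k IHk] x; first by move/V'i; apply: level_V'.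
by move=> [w Ww /IHk]; rewrite linearB => Lx; exists w.
Qed.

Let level_S k x : level k x -> level k.+1 x.
Proof.
move=> Lx; exists 0; first exact: gen0.
have -> : theta k 0 = 0 by elim: k {Lx} => //= k ->; rewrite linear0.
by rewrite subr0.
Qed.

Let level_exhaust x :
  gen (fun j => j \in i :: s) (fun y => V' y \/ y \in F) x ->
  exists k, level k x.
Proof.
apply: (gen_min (V := fun x => exists k, level k x)).
  split.
  - by exists 0%N; case: sV'.
  - move=> a x' y [k Lx] [l Ly]; exists (maxn k l).
    case: (level_submod (maxn k l)) => _ + _; apply.
      exact: (chain_mono level_S (leq_maxl k l)).
    exact: (chain_mono level_S (leq_maxr k l)).
  - move=> j x'; rewrite inE => /predU1P[->|js] [k Lx].
      by exists k.+1; apply: level_op.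
    by exists k; case: (level_submod k) => _ _; apply.
move=> y [V'y|yF]; first by exists 0%N.
exists 1%N, y; first by apply: gen_in; right.
by rewrite /= subrr; case: sV'.
Qed.

(* As in Hilbert's basis theorem: the leading coefficients of degree k of U. *)
Let lead k U w := W w /\ exists2 r, level k r & U (r + theta k w).

Let leadS k U w : (forall x, U x -> U (th i x)) -> lead k U w -> lead k.+1 U w.
Proof.
move=> Ui [Ww [r Lr Ur]]; split=> //; exists (th i r); first exact: level_op.
by rewrite /= -linearD; apply: Ui.
Qed.

(** The spaces [lead k (U n)] increase with both [k] and [n], so the hypothesis makes them
    stationary in [n] for all degrees at once; subtracting leading terms then lowers the level. *)
Lemma hilbert_step :
  acc (fun U => [/\ submod (fun j => j \in s) U, forall x, V' x -> U x
    & forall x, U x -> W x]) ->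
  acc (fun U => [/\ submod (fun j => j \in i :: s) U, forall x, V' x -> U x
    & forall x, U x ->
        gen (fun j => j \in i :: s) (fun y => V' y \/ y \in F) x]).
Proof.
move=> IH U HU US; have mU := chain_mono US.
have Ui n x : U n x -> U n (th i x).
  by case: (HU n) => -[_ _ H] _ _; apply: H; apply: mem_head.
have sub_lead k n : [/\ submod (fun j => j \in s) (lead k (U n)),
    forall x, V' x -> lead k (U n) x & forall x, lead k (U n) x -> W x].
  have [sU VU _] := HU n; split; last by move=> x [].
    have V'0 : V' 0 by case: sV'.
    have U0 : U n 0 by apply: VU.
    split.
    - split; first exact: gen0.
      exists 0; first exact: level_V'.
      by rewrite add0r; apply: theta_in (Ui n) _.
    - move=> a x y [Wx [r Lr Ur]] [Wy [t Lt Ut]]; split; first exact: gen_lin.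
      exists (a *: r + t); first by case: (level_submod k) => _ + _; apply.
      by rewrite thetaD addrACA -scalerDr; case: sU => _ + _; apply.
    - move=> j x js [Wx [r Lr Ur]]; split; first exact: gen_op.
      exists (th j r + (th j (theta k x) - theta k (th j x))).
        apply: (submodD (level_submod k)).
          by case: (level_submod k) => _ _; apply.
        by apply: level_V'; apply: theta_comm => //; apply: WV.
      rewrite -addrA subrK -linearD; case: sU => _ _; apply=> //.
      exact: in_cons.
  move=> x V'x; split; first by apply: gen_in; left.
  exists 0; first by apply: level_V'; case: sV'.
  by rewrite add0r; apply: theta_in (Ui n) _; apply: VU.
have mlead k m n x : (m <= n)%N -> lead k (U m) x -> lead k (U n) x.
  by move=> mn [Wx [r Lr Ur]]; split=> //; exists r => //; apply: mU Ur.
have mlead' k l n x : (k <= l)%N -> lead k (U n) x -> lead l (U n) x.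
  apply: (chain_mono (U := fun k => lead k (U n))) => m y.
  by apply: (@leadS m (U n) y); apply: Ui.
(* The diagonal chain settles all degrees from [N0] on; the finitely many smaller ones are then
   settled one by one. *)
have [|n x Lx|N0 HN0] := IH (fun n => lead n (U n)).
- by move=> n; apply: sub_lead.
- by apply: mlead' (leqnSn n) _; apply: mlead Lx.
have [N' HN'] : exists N, forall n, (N <= n)%N -> forall k, (k < N0)%N ->
    forall x, lead k (U n) x -> lead k (U N) x.
  have [k|N HN] := @acc_fin N0 (fun k n => forall m x, (n <= m)%N ->
      lead k (U m) x -> lead k (U n) x).
    have [n||N HN] := IH (fun n => lead k (U n)); first exact: sub_lead.
      by move=> n x; apply: mlead.
    exists N => n Nn m x nm Lx; apply: (mlead _ N) => //.
    by apply: HN Lx; apply: leq_trans nm.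
  by exists N => n Nn k kN x; apply: HN.
pose N := maxn N0 N'; exists N => n x Nn Ux.
have [_ _ Un] := HU n; have [k Lx] := level_exhaust (Un _ Ux).
have lead_stable l w : lead l (U n) w -> lead l (U N) w.
  case: (ltnP l N0) => [lN|lN] Lw.
    apply: (mlead _ N'); first exact: leq_maxr.
    by apply: HN' Lw => //; apply: leq_trans Nn; exact: leq_maxr.
  apply: (mlead _ N0); first exact: leq_maxl.
  apply: (mlead' N0) => //; apply: (HN0 (maxn l n)).
    by rewrite leq_max lN.
  by apply: mlead' (leq_maxl _ _) _; apply: mlead (leq_maxr _ _) _.
have [sUn _ _] := HU n; have [sUN VUN _] := HU N.
(* Subtracting an element of [U N] with the same leading coefficient [w] leaves an element of [U n]
   one level lower. *)
elim: k x Ux Lx => [x _ /VUN//|k IHk] x Ux [w Ww Lx].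
have [|_ [r Lr Ur]] := lead_stable k w.
  by split=> //; exists (x - theta k w) => //; rewrite subrK.
rewrite -[x](subrK (r + theta k w)); apply: (submodD sUN) => //.
apply: IHk.
  by apply: (submodB sUn) => //; apply: mU Ur.
by rewrite [r + _]addrC opprD addrA; apply: (submodB (level_submod k)).
Qed.

End HilbertStep.

Theorem hilbert_basis s V V' F :
  submod (fun j => j \in s) V -> submod (fun j => j \in s) V' ->
  (forall x, V' x -> V x) -> (forall x, x \in F -> V x) ->
  (forall i j x, i \in s -> j \in s -> V x ->
    V' (th i (th j x) - th j (th i x))) ->
  acc (fun U => [/\ submod (fun j => j \in s) U, forall x, V' x -> U x
    & forall x, U x -> gen (fun j => j \in s) (fun y => V' y \/ y \in F) x]).
Proof.
elim: s => [|i s IHs] sV sV' V'V FV comm.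
  have nilF j : j \in [::] -> False by [].
  have sub U : submod (fun j => j \in [::]) U <-> submod (fun=> False) U.
    by split; apply: submod_sub.
  move=> U HU US; apply: (acc_finite_dim (V := V') (F := F)) US => [|n].
    exact/sub.
  have [sU VU UG] := HU n; split=> //; first exact/sub.
  by move=> x /UG; apply: gen_mono.
apply: (hilbert_step sV) => //.
- by move=> j x js; apply: comm; rewrite inE ?js ?eqxx ?orbT.
- have ins j : j \in s -> j \in i :: s by rewrite inE orbC => ->.
  apply: IHs => //; first exact: submod_sub sV.
  + exact: submod_sub sV'.
  + by move=> j k x js ks; apply: comm; apply: ins.
Qed.

Definition noeth S V : Prop :=
  acc (fun U => submod S U /\ forall x, U x -> V x).

(** A chain is controlled by its intersections with [V'] and its sums with [V']. The former
    stabilise because [V'] is Noetherian, the latter by [hilbert_basis], for which only the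
    operators in [s] are kept. *)
Lemma noeth_ext S s V V' F : (forall j, j \in s -> S j) ->
  submod S V -> submod S V' -> (forall x, V' x -> V x) ->
  (forall x, x \in F -> V x) ->
  (forall i j x, i \in s -> j \in s -> V x ->
    V' (th i (th j x) - th j (th i x))) ->
  (forall x, V x -> gen (fun j => j \in s) (fun y => V' y \/ y \in F) x) ->
  noeth S V' -> noeth S V.
Proof.
move=> sS sV sV' V'V FV comm VF nV' U HU US; have mU := chain_mono US.
have sub := submod_sub sS.
have [n|n x [? ?]|N1 HN1] := nV' (fun n x => U n x /\ V' x).
- have [sU _] := HU n; split; first exact: submod_cap.
  by move=> x [].
- by split=> //; apply: US.
have [||n|n x [y ? ?]|N2 HN2] := @hilbert_basis s V V' F _ _ V'V FV comm
    (fun n x => exists2 y, U n y & V' (x - y)).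
- exact: sub.
- exact: sub.
- have [sU UV] := HU n; split.
  + by apply: sub; apply: submod_add.
  + by move=> x V'x; exists 0; rewrite ?subr0 //; case: sU.
  + move=> x [y /UV Vy /V'V Vxy]; apply: VF.
    by rewrite -[x](subrK y); apply: (submodD sV).
- by exists y => //; apply: US.
exists (maxn N1 N2) => n x nN Ux.
have [sUn _] := HU n; have [sUN _] := HU (maxn N1 N2).
have [|y Uy V'xy] := HN2 n x (leq_trans (leq_maxr _ _) nN).
  by exists x => //; rewrite subrr; case: sV'.
have {}Uy : U (maxn N1 N2) y by apply: mU Uy; exact: leq_maxr.
rewrite -[x](subrK y); apply: (submodD sUN) => //.
apply: (mU N1); first exact: leq_maxl.
have [] // := HN1 n (x - y) (leq_trans (leq_maxl _ _) nN) _; split=> //.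
by apply: (submodB sUn) => //; apply: mU Uy.
Qed.

End Submodules.

(** * Short words, multiplication operators and idempotent iterates *)

Fixpoint words (T : finType) n : seq (seq T) :=
  if n is n'.+1 then [::] :: [seq c :: w | c <- enum T, w <- words T n']
  else [:: [::]].

Lemma mem_words (T : finType) n (w : seq T) :
  (w \in words T n) = (size w <= n)%N.
Proof.
elim: n w => [|n IHn] [|c w] //=; rewrite inE /=.
apply/allpairsP/idP => [[[d v] /= [_ + [_ ->]]]|wn]; first by rewrite IHn.
by exists (c, w); rewrite mem_enum IHn.
Qed.

Section GenSpan.
Context (K : fieldType) (E : lmodType K) (I : eqType).
Context (th : I -> {linear E -> E}).

Lemma gen_submod_op (S : I -> Prop) (Q : E -> Prop) :
  (forall i x, S i -> Q x -> gen th (fun=> False) Q (th i x)) ->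
  submod th S (gen th (fun=> False) Q).
Proof.
move=> SQ; split; [exact: gen0 | exact: gen_lin|].
move=> i x Si; elim=> {x} [x /(SQ _ _ Si)//||a x y _ IHx _ IHy|//].
  by rewrite linear0; apply: gen0.
by rewrite linearP; apply: gen_lin.
Qed.

Lemma noeth_sub (S : I -> Prop) (V W : E -> Prop) : (forall x, W x -> V x) ->
  noeth th S V -> noeth th S W.
Proof.
move=> WV nV U HU; apply: nV => n; have [sU UW] := HU n.
by split=> // x /UW/WV.
Qed.

End GenSpan.

Section RightMul.
Context (K : fieldType) (A : algType K) (a : A).

Definition rmul (x : A) : A := x * a.

Fact rmul_linear : linear rmul.
Proof. by move=> c x y; rewrite /rmul mulrDl scalerAl. Qed.

HB.instance Definition _ :=
  GRing.isLinear.Build K A A _ rmul rmul_linear.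

Definition lmul (x : A) : A := a * x.

Fact lmul_linear : linear lmul.
Proof. by move=> c x y; rewrite /lmul mulrDr scalerAr. Qed.

HB.instance Definition _ :=
  GRing.isLinear.Build K A A _ lmul lmul_linear.

End RightMul.

(** By pigeonhole the orbit of [x] becomes periodic after at most [#|T|] steps, with a period at
    most [#|T|]. Such a period divides the factorial, hence [n], and [n] is large enough to reach
    the cycle. *)
Lemma iter_fact_idem (T : finType) (f : T -> T) n x :
  (0 < n)%N -> (#|T| `! %| n)%N -> iter n f (iter n f x) = iter n f x.
Proof.
move=> n0 dn.
have le_n : (#|T| <= n)%N.
  by apply: leq_trans (dvdn_leq n0 dn); exact: fact_geq.
have [i [p [ip p0 per]]] : exists i p, [/\ (i + p <= #|T|)%N, (0 < p)%N
    & iter (i + p) f x = iter i f x].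
  pose h (k : 'I_#|T|.+1) := iter k f x.
  have /injectivePn[k [l kl hkl]] : ~~ injectiveb h.
    apply/negP => /injectiveP/leq_card; rewrite card_ord.
    by rewrite ltnn.
  wlog lt_kl : k l kl hkl / (k < l)%N.
    move=> W; case: (ltngtP k l) => [|/W|/val_inj kl'].
    - exact: W.
    - by apply=> //; rewrite eq_sym.
    - by rewrite kl' eqxx in kl.
  exists k, (l - k)%N; rewrite subnKC ?(ltnW lt_kl) // subn_gt0.
  by split=> //; rewrite -ltnS.
have perk k : iter (k * p) f (iter i f x) = iter i f x.
  elim: k => // k IHk; rewrite mulSn iterD IHk -iterD addnC; exact: per.
have /dvdnP[q nq] : (p %| n)%N.
  apply: dvdn_trans dn; apply: dvdn_fact.
  by rewrite p0 (leq_trans _ ip) // leq_addl.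
have in_ : (i <= n)%N.
  by apply: leq_trans le_n; apply: leq_trans ip; exact: leq_addr.
have Ei : iter n f x = iter (n - i) f (iter i f x) by rewrite -iterD subnK.
by rewrite Ei -iterD addnC iterD nq perk.
Qed.

Lemma iter_inj_id (T : finType) (f : T -> T) n t : injective f -> (0 < n)%N ->
  (#|T| `! %| n)%N -> iter n f t = t.
Proof.
move=> f_inj n0 dn; have : iter n f (iter n f t) = iter n f t.
  exact: iter_fact_idem.
apply: (_ : injective (iter n f)).
by elim: n {n0 dn} => [|n IHn] //= y z /f_inj/IHn.
Qed.

(** * Standard polynomials *)

Definition stdpoly (R : pzRingType) m (x : 'I_m -> R) : R :=
  \sum_(s : 'S_m) (-1) ^+ s * \prod_(i < m) x (s i).

(** Expand in the [d * d] matrix units. Every term repeats a unit, so its coefficient is a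
    determinant with two equal rows. The bound is weaker than that of Amitsur and Levitzki. *)
Lemma stdpoly_matrix (C : comNzRingType) d m (X : 'I_m -> 'M[C]_d) :
  (d * d < m)%N -> stdpoly X = 0.
Proof.
move=> dm; pose J := ('I_d * 'I_d)%type.
have XE k : X k = \sum_(e : J) X k e.1 e.2 *: delta_mx e.1 e.2.
  by rewrite [LHS]matrix_sum_delta pair_bigA.
have prodZ (f : {ffun 'I_m -> J}) (c : 'I_m -> C) :
    \prod_(i < m) (c i *: (delta_mx (f i).1 (f i).2 : 'M[C]_d)) =
    (\prod_(i < m) c i) *: \prod_(i < m) delta_mx (f i).1 (f i).2.
  elim/big_rec3: _ => [|i x y z _ ->]; first by rewrite scale1r.
  by rewrite -[LHS]/(_ *m _) -scalemxAl -scalemxAr scalerA.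
pose G (s : 'S_m) (f : {ffun 'I_m -> J}) : C :=
  \prod_(i < m) X (s i) (f i).1 (f i).2.
have -> : stdpoly X = \sum_(f : {ffun 'I_m -> J})
    (\sum_(s : 'S_m) (-1) ^+ s * G s f) *:
    \prod_(i < m) delta_mx (f i).1 (f i).2.
  under [RHS]eq_bigr do rewrite scaler_suml.
  rewrite exchange_big; apply: eq_bigr => s _ /=.
  under eq_bigr do rewrite XE.
  rewrite bigA_distr_bigA mulr_sumr; apply: eq_bigr => f _.
  rewrite prodZ -scalerA -[in RHS]signr_odd -[in LHS]signr_odd.
  by case: (odd _); rewrite ?mulN1r ?scaleN1r ?mul1r ?scale1r.
rewrite big1 // => f _.
suff -> : \sum_(s : 'S_m) (-1) ^+ s * G s f = 0 by rewrite scale0r.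
have /injectivePn[i [j ij fij]] : ~~ injectiveb f.
  apply/negP => /injectiveP/leq_card; rewrite card_prod !card_ord.
  by rewrite leqNgt dm.
pose M : 'M[C]_m := \matrix_(k, l) X l (f k).1 (f k).2.
transitivity (\det M); last first.
  by apply: (determinant_alternate ij) => k; rewrite !mxE fij.
apply: eq_bigr => s _; congr (_ * _).
by apply: eq_bigr => k _; rewrite mxE.
Qed.

(** * Powers of the standard polynomial in the free algebra *)

Section FreeAlgebra.
Context (K : fieldType) (m : nat).

Local Notation free_algebra := {malg K[{fmonom 'I_m}]}.

Definition ncvar (i : 'I_m) : free_algebra := << fmu i >>.

Lemma ncvar_prod (r : seq 'I_m) : \prod_(i <- r) ncvar i = << FMonom r >>.
Proof.
elim: r => [|i r IHr]; first by rewrite big_nil -fmoneE.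
rewrite big_cons IHr malgM_def /ncvar fgmulUU mulr1; congr << _ >>.
by apply/eqP; rewrite fmP fmM fmU.
Qed.

(** A word factors uniquely once the length of its left factor is fixed. *)
Lemma mcoeff_wordM (w w' v : {fmonom 'I_m}) (f : free_algebra) :
  size w = size w' ->
  (<< w >> * f)@_(mmul w' v) = if w == w' then f@_v else 0.
Proof.
move=> sw; rewrite mcoeffMl msuppU1 big_seq_fset1 mcoeffUU.
have E (k : {fmonom 'I_m}) : (mmul w k == mmul w' v) = (w == w') && (k == v).
  by rewrite !fmP !fmM eqseq_cat.
under eq_bigr do rewrite E mul1r.
case: eqP => /= _; last by rewrite big1.
rewrite [in RHS](monalgE f) raddf_sum; apply: eq_bigr => k _.
by rewrite /= mcoeffU.
Qed.

(** The [h]-th power of the word listing all variables in order has coefficient 1: in each factor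
    only the identity permutation contributes to it. *)
Lemma stdpoly_ncvar_neq0 h : stdpoly ncvar ^+ h != 0.
Proof.
pose w0 : {fmonom 'I_m} := FMonom (index_enum 'I_m).
suff [v Hv] : exists v, (stdpoly ncvar ^+ h)@_v = 1.
  by apply: contra_eq_neq Hv => ->; rewrite mcoeff0 eq_sym oner_neq0.
elim: h => [|h [v IHv]]; first by exists mone; rewrite expr0 mcoeff1 eqxx.
exists (mmul w0 v); rewrite exprS mulr_suml raddf_sum (bigD1 (1%g : 'S_m)) //=.
have wordE (s : 'S_m) :
    \prod_(i < m) ncvar (s i) = << FMonom (map s (index_enum 'I_m)) >>.
  by rewrite -ncvar_prod big_map.
have sign_out (s : 'S_m) (f : free_algebra) : (-1) ^+ s * f = (-1) ^+ s *: f.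
  by case: (s : bool); rewrite ?expr0 ?expr1 ?mul1r ?scale1r ?mulN1r ?scaleN1r.
rewrite [X in _ + X]big1 => [|s s1];
  rewrite wordE sign_out -scalerAl mcoeffZ mcoeff_wordM ?size_map //.
  rewrite odd_perm1 expr0 mul1r addr0 ifT //.
  by rewrite fmP /= (eq_map (g := id)) ?map_id // => i; rewrite perm1.
rewrite ifF ?mulr0 //; apply: contraNF s1; rewrite fmP /= => /eqP sE.
apply/eqP/permP => i; rewrite perm1.
have /eq_in_map /(_ i) : map s (index_enum 'I_m) = map id (index_enum 'I_m).
  by rewrite map_id.
by apply; rewrite mem_index_enum.
Qed.

Context (A : algType K) (a : 'I_m -> A).

Definition word_eval (w : {fmonom 'I_m}) : A := \prod_(i <- w) a i.

Fact word_evalM : mmorphism word_eval.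
Proof.
by split=> [v w|]; rewrite /word_eval ?fm1 ?big_nil // fmM big_cat.
Qed.

HB.instance Definition _ := isMultiplicative.Build _ _ word_eval word_evalM.

Lemma nc_evalE : nc_eval a = mmap (in_alg A) word_eval.
Proof. by []. Qed.

Lemma nc_evalM : {morph nc_eval a : f g / f * g}.
Proof.
have [|evM _] := @commr_mmap_is_multiplicative _ _ _ (in_alg A) word_eval.
  by move=> f v w /=; rewrite /GRing.comm mulr_algl mulr_algr.
exact: evM.
Qed.

Lemma nc_eval1 : nc_eval a 1 = 1.
Proof. by rewrite nc_evalE mmap1. Qed.

Lemma nc_eval_stdpoly : nc_eval a (stdpoly ncvar) = stdpoly a.
Proof.
rewrite [LHS](raddf_sum (mmap (in_alg A) word_eval)); apply: eq_bigr => s _.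
rewrite [LHS]nc_evalM; congr (_ * _).
  case: (s : bool); rewrite ?expr0 ?expr1 ?nc_eval1 //.
  rewrite [LHS](raddfN (mmap (in_alg A) word_eval)); congr (- _).
  exact: nc_eval1.
elim/big_rec2: _ => [|i f x _ <-]; first exact: nc_eval1.
rewrite nc_evalM; congr (_ * _); rewrite nc_evalE mmapU /= scale1r mul1r.
by rewrite /word_eval fmU big_seq1.
Qed.

End FreeAlgebra.

Lemma PI_of_stdpoly (K : fieldType) (A : algType K) m h :
  (forall a : 'I_m -> A, stdpoly a ^+ h = 0) -> PI_algebra A.
Proof.
move=> Ah; exists m, (stdpoly (@ncvar K m) ^+ h).
split=> [|a]; first exact: stdpoly_ncvar_neq0.
rewrite -(Ah a) -nc_eval_stdpoly; elim: h {Ah} => [|h IHh].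
  exact: nc_eval1.
by rewrite !exprS nc_evalM IHh.
Qed.

(** * Growth *)

Section SpanDimension.
Context (K : fieldType) (E : lmodType K) (I : eqType).
Context (th : I -> {linear E -> E}).
Local Notation span l := (gen th (fun=> False) (fun y : E => y \in l)).

Lemma span_coef (l : seq E) x : span l x ->
  exists c : 'I_(size l) -> K, x = \sum_i c i *: l`_i.
Proof.
elim=> {x} [x xl||a x y _ [c ->] _ [d ->]|//].
- have xi : (index x l < size l)%N by rewrite index_mem.
  exists (fun i => (i == Ordinal xi)%:R).
  rewrite (bigD1 (Ordinal xi)) //= eqxx scale1r nth_index // big1 ?addr0 //.
  by move=> i /negPf->; rewrite scale0r.
- by exists (fun=> 0); rewrite big1 // => i _; rewrite scale0r.
- exists (fun i => a * c i + d i); rewrite scaler_sumr -big_split.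
  by apply: eq_bigr => i _; rewrite scalerDl scalerA.
Qed.

(** Otherwise the coefficient matrix has more rows than columns, and a nonzero vector of its left
    kernel is a linear relation. *)
Lemma lin_indep_size (s l : seq E) : lin_indep s ->
  (forall x, x \in s -> span l x) -> (size s <= size l)%N.
Proof.
move=> s_free s_span; rewrite leqNgt; apply/negP => ls.
have /choice[c Hc] (i : 'I_(size s)) :
    exists c : 'I_(size l) -> K, s`_i = \sum_j c j *: l`_j.
  by apply/span_coef/s_span/mem_nth.
pose M : 'M[K]_(size s, size l) := \matrix_(i, j) c i j.
have : kermx M != 0.
  rewrite kermx_eq0 /row_free neq_ltn; apply/orP; left.
  exact: leq_ltn_trans (rank_leq_col M) ls.
case/rowV0Pn => u /sub_kermxP uM; apply/negP/negPn/eqP/rowP => i.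
rewrite mxE; apply: (s_free (u 0)) i.
under eq_bigr do rewrite Hc scaler_sumr.
rewrite exchange_big big1 //= => j _.
under eq_bigr do rewrite scalerA.
rewrite -scaler_suml; have -> : \sum_k u 0 k * c k j = (u *m M) 0 j.
  by rewrite mxE; apply: eq_bigr => k _; rewrite mxE.
by rewrite uM mxE scale0r.
Qed.

Lemma span_dim_le (s l : seq E) :
  (forall x, x \in s -> span l x) -> (span_dim s <= size l)%N.
Proof.
move=> s_span; apply/bigmax_leqP => m /asboolP m_free.
by apply: lin_indep_size m_free _ => x /mem_mask; apply: s_span.
Qed.

End SpanDimension.

Lemma GKdim_lty (R : realType) (K : fieldType) (A : algType K) (D : nat) :
  (forall s : seq A, exists C, forall n, (growth s n <= C * n.+1 ^ D)%N) ->
  (GKdim R A < +oo)%E.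
Proof.
move=> HD; apply: (@le_lt_trans _ _ (D.+1%:R)%:E); last exact: ltry.
apply: ge_ereal_sup => _ [s _ <-]; have [C HC] := HD s.
(* For [n >= 2] the logarithm of [n] is positive, and for [n >= C * 2 ^ D] one gets [C * n.+1 ^ D <=
   C * (2 * n) ^ D <= n ^ D.+1]. *)
pose N := maxn 2 (C * 2 ^ D).
(* The upper limit is an infimum of suprema, hence at most the supremum over the tail from [N]
   on. *)
apply: (@le_trans _ _ (ereal_sup ((fun n : nat =>
    (ln (growth s n)%:R / ln n%:R : R)%:E) @` [set n | (N <= n)%N])%classic)).
  apply: ereal_inf_lbound; exists [set n | (N <= n)%N]%classic => //.
  by exists N.
apply: ge_ereal_sup => _ [n /= Nn <-]; rewrite lee_fin.
have n2 : (1 < n)%N by apply: leq_trans Nn; rewrite leq_maxl.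
have n0 : (0 < n)%N by apply: ltn_trans n2.
have ln_pos : 0 < ln n%:R :> R by apply: ln_gt0; rewrite ltr1n.
rewrite ler_pdivrMr // mulrC mulr_natr -lnXn ?ltr0n // -natrX.
have gn : (growth s n <= n ^ D.+1)%N.
  apply: leq_trans (HC n) _.
  apply: (@leq_trans (C * (2 * n) ^ D)).
    rewrite leq_mul2l; apply/orP; right.
    have [->|D0] := posnP D; first by rewrite !expn0.
    by rewrite leq_exp2r // mul2n -addnn -addn1 leq_add2l.
  rewrite expnMn mulnA expnS leq_mul2r; apply/orP; right.
  by apply: leq_trans Nn; exact: leq_maxr.
(* If the growth is 0, its logarithm takes the default value 0. *)
have [->|g0] := posnP (growth s n).
  rewrite ln0 //; apply: ln_ge0; rewrite ler1n expn_gt0 n0 //.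
by rewrite ler_ln ?posrE ?ltr0n ?ler_nat ?expn_gt0 ?n0.
Qed.

(** * Evaluation of commutative polynomials at commuting elements *)

Section CommutingEvaluation.
Context (K : fieldType) (A : algType K) (I : finType) (u : I -> A).
Hypothesis ucomm : forall i j, GRing.comm (u i) (u j).

Definition cmonom_eval (m : {cmonom I}) : A := \prod_i u i ^+ m i.

Fact cmonom_evalM : mmorphism cmonom_eval.
Proof.
split=> [m n|]; last by apply: big1 => i _; rewrite cm1.
rewrite /cmonom_eval; elim: (index_enum I) => [|i r IHr].
  by rewrite !big_nil mulr1.
rewrite !big_cons IHr cmM exprD -!mulrA; congr (_ * _); rewrite !mulrA.
congr (_ * _); apply: commr_prod => j _.
by apply/commrX/commr_sym/commrX/ucomm.
Qed.

HB.instance Definition _ := isMultiplicative.Build _ _ cmonom_eval cmonom_evalM.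

(** Through this map a genuine commutative ring acts on [A], as [stdpoly_matrix] requires. *)
Definition ceval : {malg K[{cmonom I}]} -> A := mmap (in_alg A) cmonom_eval.

HB.instance Definition _ := GRing.Additive.on ceval.

Lemma cevalM : {morph ceval : x y / x * y}.
Proof.
have [|evM _] := @commr_mmap_is_multiplicative _ _ _ (in_alg A) cmonom_eval.
  by move=> x m m' /=; rewrite /GRing.comm mulr_algl mulr_algr.
exact: evM.
Qed.

Lemma cevalZ c x : ceval (c *: x) = c *: ceval x.
Proof. by rewrite /ceval mmapZ mulr_algl. Qed.

Lemma ceval1 : ceval 1 = 1.
Proof. by rewrite /ceval mmap1. Qed.

Lemma cevalU i : ceval << ucm i >> = u i.
Proof.
rewrite /ceval mmapU /= scale1r mul1r /= /cmonom_eval.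
have : i \in index_enum I by rewrite mem_index_enum.
elim: (index_enum I) (index_enum_uniq I) => //= j r IHr /andP[jr ur].
rewrite big_cons inE => /predU1P[ij|ir].
  rewrite ij cmU eqxx expr1 big1_seq ?mulr1 // => k /= kr.
  by rewrite cmU; case: eqP kr jr => [<- ->|].
by rewrite cmU IHr //; case: eqP ir jr => [-> ->|_ _ _]; rewrite ?mul1r.
Qed.

End CommutingEvaluation.

(** * Algebras spanned by words over a finite shelf *)

Section Shelf.
Context (K : fieldType) (A : algType K) (Z : finType).
Context (tri : Z -> Z -> Z) (g : Z -> A) (p : nat).
Hypothesis triA : forall b c d, tri b (tri c d) = tri (tri b c) (tri b d).
Hypothesis gM : forall b c, g b * g c = g (tri b c) * g b.
Hypothesis p_gt0 : (0 < p)%N.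
Hypothesis idem : forall c x,
  iter p (tri c) (iter p (tri c) x) = iter p (tri c) x.

Definition ev (w : seq Z) : A := \prod_(c <- w) g c.
Definition act (w : seq Z) (x : Z) : Z := foldr tri x w.

Lemma ev_cat u v : ev (u ++ v) = ev u * ev v.
Proof. exact: big_cat. Qed.

Lemma ev_nseq n c : ev (nseq n c) = g c ^+ n.
Proof. by rewrite /ev big_nseq; elim: n => //= n ->; rewrite exprS. Qed.

Lemma act_cat u v x : act (u ++ v) x = act u (act v x).
Proof. exact: foldr_cat. Qed.

Lemma act_nseq n c x : act (nseq n c) x = iter n (tri c) x.
Proof. by elim: n => //= n ->. Qed.

Lemma act_tri w b c : act w (tri b c) = tri (act w b) (act w c).
Proof. by elim: w => //= d w ->. Qed.

Lemma act_act w u x : act w (act u x) = act (map (act w) u) (act w x).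
Proof. by elim: u => //= c u IHu; rewrite act_tri IHu. Qed.

Lemma ev_g w c : ev w * g c = g (act w c) * ev w.
Proof.
elim: w => [|d w IHw] /=; first by rewrite /ev big_nil mulr1 mul1r.
by rewrite /ev big_cons -/(ev w) -mulrA IHw !mulrA gM.
Qed.

Lemma ev_ev w u : ev w * ev u = ev (map (act w) u) * ev w.
Proof.
elim: u => [|c u IHu]; first by rewrite /ev big_nil mulr1 mul1r.
by rewrite /ev /= !big_cons mulrA ev_g -/(ev u) -mulrA IHu mulrA.
Qed.

Lemma ev_gX w c n : ev w * g c ^+ n = g (act w c) ^+ n * ev w.
Proof. by rewrite -!ev_nseq ev_ev map_nseq. Qed.

Definition stab w : {set Z} :=
  [set c | [forall x, act w (iter p (tri c) x) == act w x]].

Lemma stabP w c :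
  reflect (forall x, act w (iter p (tri c) x) = act w x) (c \in stab w).
Proof. by rewrite inE; apply: (iffP forallP) => H x; apply/eqP. Qed.

(** As [act w] is a shelf endomorphism, [act (w ++ u)] factors as [act w] followed by
    [act (map (act w) u)]. *)
Lemma stab_cat w u : stab w \subset stab (w ++ u).
Proof.
apply/fintype.subsetP => c /stabP wc; apply/stabP => x.
by rewrite !act_cat act_act wc -act_act.
Qed.

Lemma stab_eq u v : act u =1 act v -> stab u = stab v.
Proof.
move=> uv; apply/setP => c.
by apply/stabP/stabP => H x; have := H x; rewrite !uv.
Qed.

(** The length is kept for the growth estimate, and the action because it determines [stab]. *)
Definition weq u v := [/\ ev u = ev v, size u = size v & act u =1 act v].

Lemma weq_cons c u v : weq u v -> weq (c :: u) (c :: v).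
Proof.
case=> Eev Es Ea; split=> /=; last by move=> x /=; rewrite Ea.
  by rewrite /ev !big_cons -/(ev u) Eev.
by rewrite Es.
Qed.

Lemma weq_shift c v t : weq (c :: v ++ t) (map (tri c) v ++ c :: t).
Proof.
split; last 1 first.
- move=> x; rewrite /= !act_cat /=.
  by have := act_act [:: c] v (act t x).
- rewrite -cat1s catA -(cat1s c t) catA !ev_cat; congr (_ * _).
  exact: (ev_ev [:: c] v).
- by rewrite /= !size_cat size_map /= addnS.
Qed.

Lemma weq_trans u v w : weq u v -> weq v w -> weq u w.
Proof.
move=> [e s a] [e' s' a']; split; [by rewrite e | by rewrite s |].
by move=> x; rewrite a.
Qed.

(** By [weq_shift] an occurrence of [c] moves right until it joins the block already formed; only
    letters in front of the block change. *)
Lemma collect c m w : (m <= count_mem c w)%N ->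
  exists v u, weq w (v ++ nseq m c ++ u).
Proof.
elim: w m => [|d w IHw] m /=.
  by rewrite leqn0 => /eqP->; exists [::], [::].
case: (leqP m (count_mem c w)) => [/IHw[v [u wvu]] _|lt_m].
  by exists (d :: v), u; apply: weq_cons.
case: m lt_m => // m; rewrite ltnS => cm mc.
have dc : d = c.
  by apply/eqP; move: mc; case: eqP => // _; rewrite add0n ltnNge cm.
have /IHw[v [u wvu]] : (m <= count_mem c w)%N.
  by move: mc; rewrite dc eqxx add1n.
exists (map (tri c) v), u; rewrite dc.
by apply: weq_trans (weq_cons c wvu) _; apply: weq_shift.
Qed.

Lemma stab_nseq v c : c \in stab (v ++ nseq p c).
Proof. by apply/stabP => x; rewrite !act_cat !act_nseq idem. Qed.

(* Of 2p occurrences of c, the first p put c into the stabiliser of the prefix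
   and the last p can then be moved to the right end without any effect. *)
Lemma extract_power c w : (2 * p <= count_mem c w)%N ->
  exists v, [/\ act v =1 act w, (size v + p = size w)%N, c \in stab v
    & ev w = ev v * g c ^+ p].
Proof.
move=> /collect[v [u [Eev Es Ea]]].
pose t := map (iter p (tri c)) u.
have tE : t = map (act (nseq p c)) u by apply: eq_map => x; rewrite act_nseq.
exists ((v ++ nseq p c) ++ t); rewrite mul2n -addnn nseqD in Eev Es Ea.
have sc := stab_nseq v c; have /stabP sc' := sc.
split.
- move=> x; rewrite Ea act_cat act_act -map_comp.
  rewrite (eq_map (g := act (v ++ nseq p c))); last by move=> y /=; apply: sc'.
  by rewrite -act_act !act_cat !act_nseq idem.
- by rewrite Es !size_cat !size_nseq size_map; lia.
- exact: (fintype.subsetP (stab_cat _ _)) sc.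
- by rewrite Eev -catA !ev_cat -ev_nseq tE -!mulrA -ev_ev.
Qed.

Lemma long_count w : (size w > #|Z| * (2 * p))%N ->
  exists c : Z, (2 * p <= count_mem c w)%N.
Proof.
move=> lw; apply: contrapT => nex.
suff : (size w <= #|Z| * (2 * p))%N by rewrite leqNgt lw.
have -> : size w = (\sum_(c : Z) count (@pred1 Z c) w)%N.
  elim: w {lw nex} => [|d w IHw] /=; first by rewrite big1.
  rewrite big_split /= -IHw (bigD1 d) //= eqxx big1 ?addn0 // => c.
  by rewrite eq_sym => /negPf->.
rewrite -sum_nat_const; apply: leq_sum => c _.
by rewrite leqNgt; apply/negP => /ltnW cp; apply: nex; exists c.
Qed.

Definition pows (cs : seq Z) : A := \prod_(c <- cs) g c ^+ p.

(** Powers are split off by [extract_power] as long as [long_count] finds a frequent letter. The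
    action, hence [stab], never changes, and the length identity later bounds the number of
    powers. *)
Lemma normal_form w : exists f cs,
  [/\ (size f <= #|Z| * (2 * p))%N, act f =1 act w,
      (size f + p * size cs = size w)%N, {subset cs <= stab w}
    & ev w = ev f * pows cs].
Proof.
have [n] := ubnP (size w); elim: n w => // n IHn w; rewrite ltnS => wn.
case: (leqP (size w) (#|Z| * (2 * p))) => [sw|/long_count[c /extract_power]].
  by exists w, [::]; rewrite /pows big_nil mulr1 muln0 addn0.
move=> [v [av sv cv Ew]].
have [|f [cs [sf af scs csv Ev]]] := IHn v.
  by apply: leq_trans wn; rewrite -sv -addn1 leq_add2l.
exists f, (rcons cs c); split=> //.
- by move=> x; rewrite af av.
- by rewrite size_rcons mulnS addnCA scs addnC.
- move=> d; rewrite mem_rcons inE -(stab_eq av) => /predU1P[->//|/csv//].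
- by rewrite Ew Ev /pows -cats1 big_cat big_seq1 mulrA.
Qed.

(** Pulled left through [g c ^+ p] and [ev w], the letter [d] becomes [act w (iter p (tri c) d)],
    which is [act w d]; pushing it back through [ev w] alone swaps the two powers. *)
Lemma stab_comm w c d : c \in stab w -> d \in stab w ->
  ev w * g c ^+ p * g d ^+ p = ev w * g d ^+ p * g c ^+ p.
Proof.
move=> /stabP cw /stabP dw; rewrite -mulrA -ev_nseq ev_gX mulrA ev_gX.
by rewrite act_nseq cw -ev_gX.
Qed.

Local Notation rm := (fun a : A => rmul a : {linear A -> A}).
Local Notation lm := (fun a : A => lmul a : {linear A -> A}).
Local Notation span := (gen rm (fun=> False)).
Local Notation isev := (fun a : A => exists w, a = ev w).

(** * Right ideals: stratification by [stab] *)

Section RightNoetherian.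
Context (V0 : A -> Prop) (f : A).
Hypothesis sV0 : submod rm isev V0.

(** [V0] holds the contribution of the prefixes treated before [f]. *)
Definition stratum (D : {set {set Z}}) : A -> Prop :=
  span (fun y => V0 y \/ exists2 w, stab w \in D & y = f * ev w).

Definition upclosed (D : {set {set Z}}) : Prop :=
  forall s t : {set Z}, s \subset t -> s \in D -> t \in D.

Lemma stratum_submod D : upclosed D -> submod rm isev (stratum D).
Proof.
move=> Dup; apply: gen_submod_op => _ x [u ->] [V0x|[w wD ->]]; apply: gen_in.
  by left; case: sV0 => _ _; apply=> //; exists u.
right; exists (w ++ u); first exact: Dup (stab_cat w u) wD.
by rewrite /= /rmul ev_cat mulrA.
Qed.

(** Induction on the size of [D], removing a member [s] of least size. Modulo the smaller stratum
    only words with [stab] equal to [s] matter; behind them the powers of letters of [s] commute,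
    and short words generate by [normal_form], so [noeth_ext] applies. *)
Lemma stratum_noeth D : upclosed D -> noeth rm isev V0 ->
  noeth rm isev (stratum D).
Proof.
move=> + nV0; have [n] := ubnP #|D|; elim: n D => // n IHn D Dn Dup.
have [D0|[s0 s0D]] := set_0Vmem D.
  apply: noeth_sub nV0 => x; apply: gen_min; first exact: submod_sub sV0.
  by move=> y [//|[w]]; rewrite D0 inE.
have [s] := arg_minnP (fun s : {set Z} => #|s|) s0D.
move=> sD smin; have {}sD : s \in D := sD.
pose D' := D :\ s.
(* By minimality no other member of [D] is contained in [s]. *)
have D'up : upclosed D'.
  move=> t u tu /setD1P[ts tD]; rewrite !inE (Dup _ _ tu tD) andbT.
  apply: contraNneq ts => us; rewrite us in tu.
  by rewrite eqEcard tu smin.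
have subD x : stratum D' x -> stratum D x.
  apply: gen_mono => // y [V0y|[w /setD1P[_ wD] ->]]; first by left.
  by right; exists w.
pose powers := [seq g c ^+ p | c <- enum s].
have powersP a : a \in powers -> exists2 c, c \in s & a = g c ^+ p.
  by move=> /mapP[c]; rewrite mem_enum => cs ->; exists c.
pose F := [seq f * ev u | u <- words Z (#|Z| * (2 * p)) & stab u == s].
apply: (@noeth_ext _ _ _ rm isev powers (stratum D) (stratum D') F) => //.
- by move=> a /powersP[c _ ->]; exists (nseq p c); rewrite ev_nseq.
- exact: stratum_submod.
- exact: stratum_submod.
- move=> x /mapP[u]; rewrite mem_filter => /andP[/eqP us _] ->.
  by apply: gen_in; right; exists u; rewrite ?us.
- move=> a b x /powersP[c cs ->] /powersP[d ds ->].
  have sD' := stratum_submod D'up.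
  elim=> {x} [x|||//].
  + case=> [V0x|[w wD ->]].
      have V0P e y : V0 y -> V0 (y * g e ^+ p).
        case: sV0 => _ _ H V0y; apply: H => //.
        by exists (nseq p e); rewrite ev_nseq.
      by apply: gen_in; left; apply: (submodB sV0); apply/V0P/V0P.
    have [ws|nws] := eqVneq (stab w) s.
      rewrite /= /rmul -!mulrA !(mulrA (ev w)) stab_comm ?ws // subrr.
      exact: gen0.
    have D'P e v : stab v \in D' -> exists2 u, stab u \in D' &
        f * ev v * g e ^+ p = f * ev u.
      move=> vD'; exists (v ++ nseq p e); first exact: D'up (stab_cat _ _) vD'.
      by rewrite ev_cat ev_nseq mulrA.
    have wD' : stab w \in D' by rewrite !inE nws.
    have [u1 u1D e1] := D'P d w wD'; have [u2 u2D e2] := D'P c u1 u1D.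
    have [v1 v1D f1] := D'P c w wD'; have [v2 v2D f2] := D'P d v1 v1D.
    rewrite /= /rmul e1 e2 f1 f2; apply: (submodB sD'); apply: gen_in; right.
      by exists u2.
    by exists v2.
  + by rewrite /= /rmul !mul0r subr0; apply: gen0.
  + move=> k x y _ IHx _ IHy; rewrite /= /rmul !(mulrDl, =^~ scalerAl).
    rewrite opprD addrACA -scalerBr.
    exact: gen_lin.
- move=> x; apply: gen_min; first exact: submod_sub (gen_submod _ _ _).
  move=> y [V0y|[w wD ->]].
    by apply: gen_in; left; apply: gen_in; left.
  have [ws|nws] := eqVneq (stab w) s; last first.
    by apply: gen_in; left; apply: gen_in; right; exists w; rewrite // !inE nws.
  have [u [cs [su au _ csw ->]]] := normal_form w.
  rewrite mulrA /pows; elim/last_ind: cs csw => [|cs c IHcs] csw.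
    rewrite big_nil mulr1; apply: gen_in; right; apply/mapP; exists u => //.
    by rewrite mem_filter mem_words su (stab_eq au) ws eqxx.
  rewrite -cats1 big_cat big_seq1 /= mulrA.
  apply: (gen_op (th := rm) (i := g c ^+ p)).
    by apply: map_f; rewrite mem_enum -ws csw // mem_rcons mem_head.
  by apply: IHcs => d dcs; apply: csw; rewrite mem_rcons inE dcs orbT.
- apply: IHn => //; move: Dn; rewrite ltnS; apply: leq_trans.
  by rewrite [X in (_ < X)%N](cardsD1 s) sD.
Qed.

End RightNoetherian.

Lemma shelf_right_noeth (fs : seq A) :
  noeth rm isev (span (fun y => exists f w, f \in fs /\ y = f * ev w)).
Proof.
elim: fs => [|f fs IHfs].
  move=> U HU _; exists 0%N => n x _ Ux; have [[U0 _ _] _] := HU 0%N.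
  have [_ UV] := HU n; suff -> : x = 0 by [].
  elim: (UV x Ux) => // [y [f [w []]]//|a y z _ -> _ ->].
  by rewrite scaler0 addr0.
pose V0 := span (fun y => exists f w, f \in fs /\ y = f * ev w).
apply: (noeth_sub (V := stratum V0 f [set: {set Z}])); last first.
  apply: stratum_noeth IHfs; last by move=> s t _ _; rewrite inE.
  apply: gen_submod_op.
  move=> _ _ [u ->] [h [w [hfs ->]]]; apply: gen_in; exists h, (w ++ u).
  by rewrite /= /rmul ev_cat mulrA.
apply: gen_mono => // _ [h [w [+ ->]]]; rewrite inE => /predU1P[->|hfs].
  by right; exists w; rewrite ?inE.
by left; apply: gen_in; exists h, w.
Qed.

(** * Reordering the powers and counting normal forms *)

Lemma pows_cons c cs : pows (c :: cs) = g c ^+ p * pows cs.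
Proof. exact: big_cons. Qed.

Lemma pows_cat cs ds : pows (cs ++ ds) = pows cs * pows ds.
Proof. exact: big_cat. Qed.

Lemma pows_swap w cs c : {subset cs <= stab w} -> c \in stab w ->
  ev w * pows cs * g c ^+ p = ev w * g c ^+ p * pows cs.
Proof.
elim: cs w => [|d cs IHcs] w csw cw; first by rewrite /pows big_nil !mulr1.
have dw : d \in stab w by apply: csw; rewrite mem_head.
have sub := fintype.subsetP (stab_cat w (nseq p d)).
have /IHcs : {subset cs <= stab (w ++ nseq p d)}.
  by move=> e ecs; apply/sub/csw; rewrite inE ecs orbT.
move=> /(_ (sub _ cw)); rewrite ev_cat ev_nseq => IH.
by rewrite pows_cons !mulrA IH (stab_comm dw cw).
Qed.

(** The first power is absorbed into [w], whose [stab] can only grow, and is swapped to its new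
    place by [pows_swap]. *)
Lemma pows_perm w cs ds : {subset cs <= stab w} -> perm_eq cs ds ->
  ev w * pows cs = ev w * pows ds.
Proof.
elim: cs w ds => [|c cs IHcs] w ds csw cds.
  by move: cds; rewrite perm_sym => /perm_nilP->.
have cw : c \in stab w by apply: csw; rewrite mem_head.
have cd : c \in ds by rewrite -(perm_mem cds) mem_head.
have dsw : {subset ds <= stab w} by move=> d; rewrite -(perm_mem cds) => /csw.
case/splitPr: cd dsw cds => d1 d2 dsw.
rewrite -(cat1s c d2) perm_sym perm_catCA /=.
rewrite perm_cons perm_sym => csd.
have sub := fintype.subsetP (stab_cat w (nseq p c)).
have /IHcs/(_ csd) : {subset cs <= stab (w ++ nseq p c)}.
  by move=> e ecs; apply/sub/csw; rewrite inE ecs orbT.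
rewrite ev_cat ev_nseq pows_cons pows_cat pows_cat pows_cons !mulrA => ->.
by rewrite pows_swap // => e ed; apply: dsw; rewrite mem_cat ed.
Qed.

(** Exponent vectors replace lists of powers, which makes the count polynomial in [n] of degree
    [#|Z|]. *)
Definition normal_words n : seq A :=
  [seq ev f * pows (flatten [seq nseq (m c : nat) c | c <- enum Z])
     | f <- words Z (#|Z| * (2 * p)), m : {ffun Z -> 'I_n.+1} <- enum predT].

Lemma size_normal_words n : size (normal_words n) =
  (size (words Z (#|Z| * (2 * p))) * n.+1 ^ #|Z|)%N.
Proof. by rewrite size_allpairs -cardE card_ffun card_ord. Qed.

Lemma mem_normal_words n w : (size w <= n)%N -> ev w \in normal_words n.
Proof.
move=> wn; have [f [cs [sf af scs csw Ew]]] := normal_form w.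
have cn (c : Z) : (count_mem c cs < n.+1)%N.
  rewrite ltnS; apply: leq_trans (count_size _ _) _.
  apply: leq_trans wn; rewrite -scs; apply: leq_trans (leq_addl _ _).
  exact: leq_pmull.
apply/allpairsP; exists (f, [ffun c => Ordinal (cn c)]) => /=.
split; rewrite ?mem_words ?mem_enum //= Ew.
apply: pows_perm; first by move=> c; rewrite (stab_eq af) => /csw.
apply/allP => c _ /=; rewrite count_flatten sumnE 2!big_map big_enum /=.
rewrite (bigD1 c) //= ffunE /= count_nseq /= eqxx mul1n big1 ?addn0 // => d dc.
by rewrite count_nseq /= (negPf dc).
Qed.

(** * Left ideals when the powers are central *)

Lemma powC w c : (forall d x, iter p (tri d) x = x) ->
  ev w * g c ^+ p = g c ^+ p * ev w.
Proof.
move=> iterE; rewrite -ev_nseq [RHS]ev_ev; congr (ev _ * _).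
by rewrite (eq_map (g := id)) ?map_id // => x; rewrite act_nseq.
Qed.

(** All powers move to the far left, through short words and through [fs], so finitely many products
    generate the algebra under commuting left multiplications; [noeth_ext] is applied over the zero
    subspace. *)
Lemma shelf_left_noeth (fs : seq A) : (forall c x, iter p (tri c) x = x) ->
  (forall f c, f \in fs -> exists d, f * g c ^+ p = g d ^+ p * f) ->
  (forall x, span (fun y => exists f w, f \in fs /\ y = f * ev w) x) ->
  noeth lm (fun=> True) (fun=> True).
Proof.
move=> iterE fsP fsA.
pose powers := [seq g c ^+ p | c <- enum Z].
pose F := [seq f * ev u | f <- fs, u <- words Z (#|Z| * (2 * p))].
apply: (@noeth_ext _ _ _ lm (fun=> True) powers (fun=> True)
  (fun x => x = 0) F).
- by [].
- by [].
- split=> //; first by move=> a x y -> ->; rewrite scaler0 addr0.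
  by move=> a x _ ->; rewrite linear0.
- by [].
- by [].
- move=> _ _ x /mapP[c _ ->] /mapP[d _ ->] _.
  have := powC (nseq p c) d iterE; rewrite ev_nseq /= /lmul !mulrA => ->.
  by rewrite subrr.
- move=> x _; apply: gen_min (fsA x).
    by split=> //; [apply: gen0 | apply: gen_lin].
  move=> _ [f [w [ffs ->]]]; have [u [cs [su _ _ _ ->]]] := normal_form w.
  have -> : ev u * pows cs = pows cs * ev u.
    elim: cs => [|c cs IHcs]; first by rewrite /pows big_nil mulr1 mul1r.
    by rewrite pows_cons mulrA powC // -mulrA IHcs mulrA.
  elim: cs => [|c cs IHcs].
    rewrite /pows big_nil mul1r; apply: gen_in; right.
    by apply/allpairsP; exists (f, u); rewrite mem_words.
  have [d fd] := fsP f c ffs.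
  rewrite pows_cons !mulrA fd -!mulrA.
  apply: (gen_op (th := lm) (i := g d ^+ p)) => //.
  by apply: map_f; rewrite mem_enum.
- move=> U HU _; exists 0%N => n x _ Ux; have [[U0 _ _] _] := HU 0%N.
  by have [_ /(_ x Ux) ->] := HU n.
Qed.

(** * Polynomial identities: layers by [fixer] *)

Definition fixer w : {set Z} :=
  [set d | [forall x, iter p (tri d) (act w x) == act w x]].

Lemma fixerP w d :
  reflect (forall x, iter p (tri d) (act w x) = act w x) (d \in fixer w).
Proof. by rewrite inE; apply: (iffP forallP) => H x; apply/eqP. Qed.

Lemma fixer_cat w u : fixer w \subset fixer (w ++ u).
Proof.
by apply/fintype.subsetP => d /fixerP dw; apply/fixerP => x; rewrite act_cat dw.
Qed.

Lemma fixer_eq u v : act u =1 act v -> fixer u = fixer v.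
Proof.
move=> uv; apply/setP => d.
by apply/fixerP/fixerP => H x; have := H x; rewrite !uv.
Qed.

(** Moving a power of [c] to the left of [w] replaces [c] by [act w c], so [fixer] is the left-hand
    counterpart of [stab]. *)
Lemma act_stab w c : c \in stab w -> act w c \in fixer w.
Proof.
move=> /stabP cw; apply/fixerP => x; rewrite -[RHS]cw -!act_nseq.
by rewrite [RHS]act_act map_nseq.
Qed.

Lemma pows_comm w cs : ev w * pows cs = pows (map (act w) cs) * ev w.
Proof.
elim: cs => [|c cs IHcs]; first by rewrite /pows !big_nil mulr1 mul1r.
by rewrite pows_cons mulrA ev_gX -mulrA IHcs mulrA /= pows_cons.
Qed.

Definition wordspan : A -> Prop := span isev.

Lemma wordspan_submod : submod rm (fun=> False) wordspan.
Proof. exact: gen_submod. Qed.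

Definition layer (P : {set Z} -> Prop) : A -> Prop :=
  span (fun y => exists2 w, P (fixer w) & y = ev w).

Lemma layer_submod P : submod rm (fun=> False) (layer P).
Proof. exact: gen_submod. Qed.

Lemma layer_mulr (P : {set Z} -> Prop) x y :
  (forall s t : {set Z}, s \subset t -> P s -> P t) ->
  layer P x -> wordspan y -> layer P (x * y).
Proof.
move=> Pup Px; elim=> {y} [_ [u ->]||c y z _ IHy _ IHz|//].
- elim: Px => {x} [_ [w Pw ->]||c x y _ IHx _ IHy|//].
  + apply: gen_in; exists (w ++ u); last by rewrite ev_cat.
    exact: Pup (fixer_cat w u) Pw.
  + by rewrite mul0r; apply: gen0.
  + by rewrite mulrDl -scalerAl; apply: gen_lin.
- by rewrite mulr0; apply: gen0.
- by rewrite mulrDr -scalerAr; apply: gen_lin.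
Qed.

Lemma wordspanM x y : wordspan x -> wordspan y -> wordspan (x * y).
Proof.
have E z : wordspan z <-> layer (fun=> True) z.
  by split; apply: gen_mono => // t [w]; [| move=> _]; move=> ->; exists w.
by move=> /E Bx By; apply/E; apply: layer_mulr By.
Qed.

Lemma wordspan1 : wordspan 1.
Proof. by apply: gen_in; exists [::]; rewrite /ev big_nil. Qed.

Section FixerLayer.
Context (D : {set Z}).

Local Notation V := (layer (fun s => D \subset s)).
Local Notation V' := (layer (fun s => D \proper s)).

(** Lying in the image of [act w] makes such a letter fixed by [iter p (tri e)] for every [e] in
    [D], so the powers of these letters commute. *)
Definition coeffb (d : Z) : bool :=
  (d \in D) && `[< exists w x, fixer w = D /\ d = act w x >].

(** With the central default 1, all of [Z] can index the variables of the polynomial ring. *)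
Definition coeff (d : Z) : A := if coeffb d then g d ^+ p else 1.

Lemma coeff_comm d e : GRing.comm (coeff d) (coeff e).
Proof.
rewrite /coeff; case: ifP => [/andP[dD _]|_]; last exact: commr_sym (commr1 _).
case: ifP => [/andP[eD /asboolP[w [x [wD ex]]]]|_]; last exact: commr1.
rewrite /GRing.comm -ev_nseq ev_gX; congr (g _ ^+ p * _).
by rewrite act_nseq ex; apply/fixerP; rewrite wD.
Qed.

Local Notation ceval := (ceval coeff).
Local Notation C := {malg K[{cmonom Z}]}.

(** Prefixing [p] copies of a letter of [fixer w] leaves the action of [w], hence its [fixer],
    unchanged. *)
Lemma layer_coeff d x : V' x -> V' (coeff d * x).
Proof.
rewrite /coeff; case: ifP => [/andP[dD _]|_ V'x]; last by rewrite mul1r.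
elim=> {x} [_ [w Dw ->]||c x y _ IHx _ IHy|//].
- apply: gen_in; exists (nseq p d ++ w); last by rewrite ev_cat ev_nseq.
  rewrite (@fixer_eq _ w) // => x; rewrite act_cat act_nseq.
  by apply/fixerP; apply: fintype.subsetP (proper_sub Dw) _ dD.
- by rewrite mulr0; apply: gen0.
- by rewrite mulrDr -scalerAr; apply: gen_lin.
Qed.

Lemma layer_ceval c x : V' x -> V' (ceval c * x).
Proof.
move=> V'x; rewrite /ceval mmapE mulr_suml.
have sV' := layer_submod (fun s => D \proper s).
apply: (submod_sum _ sV').
move=> m _ /=; rewrite mulr_algl -scalerAl; apply: (submodZ _ sV').
rewrite /cmonom_eval; elim: (index_enum Z) => [|d r IHr].
  by rewrite big_nil mul1r.
rewrite big_cons -mulrA; elim: (m d) => [|k IHk]; first by rewrite expr0 mul1r.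
by rewrite exprS -mulrA; apply: layer_coeff.
Qed.

Lemma ceval_pows ds : {subset ds <= coeffb} -> exists c : C, ceval c = pows ds.
Proof.
elim: ds => [|d ds IHds] dsD.
  by exists 1; rewrite (ceval1 coeff_comm) /pows big_nil.
have [|c Ec] := IHds; first by move=> e eds; apply: dsD; rewrite inE eds orbT.
exists (<< ucm d >> * c); rewrite (cevalM coeff_comm) Ec cevalU pows_cons.
have db : coeffb d := dsD d (mem_head _ _).
by rewrite /coeff db.
Qed.

Local Notation shortw := (words Z (#|Z| * (2 * p))).
Local Notation N := (size shortw).

(** The default 0 keeps the number of generators independent of [D], so one standard polynomial
    serves all layers. *)
Definition layer_gen (i : 'I_N) : A :=
  let w := nth [::] shortw i in if fixer w == D then ev w else 0.

Lemma layer_genV i : V (layer_gen i).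
Proof.
rewrite /layer_gen; case: eqP => [E|_]; last exact: gen0.
by apply: gen_in; exists (nth [::] shortw i); rewrite ?E.
Qed.

(** Modulo [V'] only words with [fixer] equal to [D] remain; the powers in their normal form, moved
    to the left, become a monomial in the [coeff]. *)
Lemma layer_fg y : V y ->
  exists q : 'I_N -> C, V' (y - \sum_i ceval (q i) * layer_gen i).
Proof.
elim=> {y} [_ [w Dw ->]||a x y _ [q Hq] _ [r Hr]|//].
- have [wD|nwD] := eqVneq (fixer w) D; last first.
    exists (fun=> 0); rewrite big1 => [|i _]; last by rewrite raddf0 mul0r.
    rewrite subr0; apply: gen_in; exists w => //.
    by rewrite finset.properEneq eq_sym nwD.
  have [f [cs [sf af _ csw Ew]]] := normal_form w.
  have fD : fixer f = D by rewrite -wD; apply: fixer_eq.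
  have [|c Ec] := @ceval_pows (map (act f) cs).
    move=> _ /mapP[c /csw cw ->]; rewrite unfold_in; apply/andP; split.
      by rewrite -fD act_stab // (stab_eq af).
    by apply/asboolP; exists f, c.
  have fi : (index f shortw < N)%N by rewrite index_mem mem_words.
  exists (fun i => if i == Ordinal fi then c else 0).
  rewrite (bigD1 (Ordinal fi)) //= eqxx big1 => [|i /negPf->]; last first.
    by rewrite raddf0 mul0r.
  rewrite addr0 /layer_gen /= nth_index ?mem_words // fD eqxx Ec -pows_comm -Ew.
  by rewrite subrr; apply: gen0.
- exists (fun=> 0); rewrite big1 => [|i _]; last by rewrite raddf0 mul0r.
  by rewrite subrr; apply: gen0.
- exists (fun i => a *: q i + r i).
  have -> : \sum_i ceval (a *: q i + r i) * layer_gen i =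
      a *: (\sum_i ceval (q i) * layer_gen i) +
      \sum_i ceval (r i) * layer_gen i.
    rewrite scaler_sumr -big_split; apply: eq_bigr => i _ /=.
    by rewrite raddfD /= (cevalZ coeff_comm) mulrDl scalerAl.
  by rewrite opprD addrACA -scalerBr; apply: gen_lin.
Qed.

(** * Matrices acting from the right on rows over a layer *)

Section Rows.
Context (n : nat).

Definition row_in (P : A -> Prop) (r : 'rV[A]_n) : Prop := forall j, P (r 0 j).
Definition mx_in (P : A -> Prop) (Y : 'M[A]_n) : Prop := forall i j, P (Y i j).

Let sV' := layer_submod (fun s => D \proper s).

Let V'up (s t : {set Z}) : s \subset t -> D \proper s -> D \proper t.
Proof. by move=> st Ds; apply: fintype.proper_sub_trans st. Qed.

Let Vup (s t : {set Z}) : s \subset t -> D \subset s -> D \subset t.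
Proof. by move=> st Ds; apply: fintype.subset_trans st. Qed.

Lemma row_in0 : row_in V' 0.
Proof. by move=> j; rewrite mxE; apply: gen0. Qed.

Lemma row_inD r t : row_in V' r -> row_in V' t -> row_in V' (r + t).
Proof. by move=> Vr Vt j; rewrite mxE; apply: (submodD sV'). Qed.

Lemma row_inN r : row_in V' r -> row_in V' (- r).
Proof.
by move=> Vr j; rewrite mxE -scaleN1r; apply: (submodZ _ sV').
Qed.

Lemma row_in_sum (J : Type) (s : seq J) (F : J -> 'rV[A]_n) :
  (forall j, row_in V' (F j)) -> row_in V' (\sum_(j <- s) F j).
Proof.
move=> VF; elim/big_rec: _ => [|j r _ Vr]; first exact: row_in0.
exact: row_inD.
Qed.

Lemma row_in_ceval c r : row_in V' r -> row_in V' (ceval c *: r).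
Proof. by move=> Vr j; rewrite mxE; apply: layer_ceval. Qed.

Lemma row_in_mul r Y : row_in V' r -> mx_in wordspan Y -> row_in V' (r *m Y).
Proof.
move=> Vr BY j; rewrite mxE; apply: (submod_sum _ sV') => k _.
by apply: layer_mulr; [exact: V'up | exact: Vr | exact: BY].
Qed.

Local Notation J := ('I_n * 'I_N)%type.

Definition row_gen (a : 'I_#|{: J}|) : 'rV[A]_n :=
  layer_gen (enum_val a).2 *: delta_mx 0 (enum_val a).1.

(* Modulo V', right multiplication by Y acts on the generators through the
   matrix Q over the commutative ring C. *)
Definition represents (Y : 'M[A]_n) (Q : 'M[C]_#|{: J}|) : Prop :=
  mx_in wordspan Y /\ forall a, row_in V'
    (row_gen a *m Y - \sum_b ceval (Q a b) *: row_gen b).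

Lemma represents_ex Y : mx_in wordspan Y -> exists Q, represents Y Q.
Proof.
move=> BY.
have /choice[q Hq] (t : 'I_N * ('I_n * 'I_n)) : exists q : 'I_N -> C,
    V' (layer_gen t.1 * Y t.2.1 t.2.2 - \sum_i ceval (q i) * layer_gen i).
  apply: layer_fg; apply: layer_mulr Vup _ (BY _ _).
  exact: layer_genV.
exists (\matrix_(a, b) q ((enum_val a).2, ((enum_val a).1, (enum_val b).1))
  (enum_val b).2); split=> // a j.
suff -> : (row_gen a *m Y - \sum_b ceval ((\matrix_(a, b)
    q ((enum_val a).2, ((enum_val a).1, (enum_val b).1)) (enum_val b).2) a b)
    *: row_gen b) 0 j =
    layer_gen (enum_val a).2 * Y (enum_val a).1 j -
    \sum_i ceval (q ((enum_val a).2, ((enum_val a).1, j)) i) * layer_gen i.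
  exact: (Hq ((enum_val a).2, ((enum_val a).1, j))).
rewrite !mxE; congr (_ - _).
  rewrite (bigD1 (enum_val a).1) //= !mxE !eqxx mulr1 big1 ?addr0 //.
  move=> k /negPf ka.
  by rewrite !mxE ka andbF mulr0 mul0r.
rewrite summxE.
under eq_bigr do rewrite !mxE.
pose F (e : J) := ceval (q ((enum_val a).2, ((enum_val a).1, e.1)) e.2) *
  (layer_gen e.2 * (j == e.1)%:R).
rewrite (eq_bigr (fun b => F (enum_val b))) //.
rewrite -(big_enum_val F) /= -(pair_bigA _ (fun k i => F (k, i))) /=.
rewrite (bigD1 j) //= [X in _ + X]big1 ?addr0 => [|k kj].
  by apply: eq_bigr => i _; rewrite /F /= eqxx mulr1.
by apply: big1 => i _; rewrite /F /= eq_sym (negPf kj) !mulr0.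
Qed.

Lemma represents1 : represents 1%:M 1%:M.
Proof.
split=> [i j|a].
  by rewrite mxE; case: eqP => _; [exact: wordspan1 | exact: gen0].
rewrite mulmx1 (bigD1 a) //= big1 => [|b ba].
  by rewrite mxE eqxx (ceval1 coeff_comm) scale1r addr0 subrr; apply: row_in0.
by rewrite mxE eq_sym (negPf ba) raddf0 scale0r.
Qed.

(** Coefficients act from the left and commute with right multiplication by [Y']; the error terms
    stay in [V'], which is stable under both. *)
Lemma representsM Y Y' Q Q' : represents Y Q -> represents Y' Q' ->
  represents (Y *m Y') (Q *m Q').
Proof.
move=> [BY HY] [BY' HY']; split=> [i j|a].
  rewrite mxE; apply: (submod_sum _ wordspan_submod) => k _.
  exact: wordspanM.
have -> : \sum_c ceval ((Q *m Q') a c) *: row_gen c =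
    \sum_b ceval (Q a b) *: (\sum_c ceval (Q' b c) *: row_gen c).
  under [RHS]eq_bigr do rewrite scaler_sumr.
  rewrite exchange_big /=; apply: eq_bigr => c _.
  rewrite mxE raddf_sum scaler_suml; apply: eq_bigr => b _.
  by rewrite /= (cevalM coeff_comm) scalerA.
set T := row_gen a *m Y - \sum_b ceval (Q a b) *: row_gen b.
have -> : row_gen a *m (Y *m Y') = T *m Y' +
    \sum_b ceval (Q a b) *: (row_gen b *m Y').
  rewrite mulmxBl mulmx_suml mulmxA.
  under [X in _ - X]eq_bigr do rewrite -scalemxAl.
  by rewrite subrK.
rewrite -addrA -sumrB; apply: row_inD; first exact: row_in_mul (HY a) BY'.
by apply: row_in_sum => b; rewrite -scalerBr; apply: row_in_ceval.
Qed.

Lemma representsD Y Y' Q Q' : represents Y Q -> represents Y' Q' ->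
  represents (Y + Y') (Q + Q').
Proof.
move=> [BY HY] [BY' HY']; split=> [i j|a].
  by rewrite mxE; apply: (submodD wordspan_submod).
have -> : \sum_b ceval ((Q + Q') a b) *: row_gen b =
    \sum_b ceval (Q a b) *: row_gen b + \sum_b ceval (Q' a b) *: row_gen b.
  by rewrite -big_split; apply: eq_bigr => b _; rewrite mxE raddfD scalerDl.
by rewrite mulmxDr opprD addrACA; apply: row_inD.
Qed.

Lemma representsN Y Q : represents Y Q -> represents (- Y) (- Q).
Proof.
move=> [BY HY]; split=> [i j|a].
  by rewrite mxE -scaleN1r; apply: (submodZ _ wordspan_submod).
have -> : \sum_b ceval ((- Q) a b) *: row_gen b =
    - \sum_b ceval (Q a b) *: row_gen b.
  by rewrite -sumrN; apply: eq_bigr => b _; rewrite mxE raddfN scaleNr.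
by rewrite mulmxN -opprD; apply: row_inN.
Qed.

Lemma represents0 : represents 0 0.
Proof.
by have := representsD represents1 (representsN represents1); rewrite !subrr.
Qed.

Lemma represents_stdpoly m (Y : 'I_m -> 'M[A]_n) (Q : 'I_m -> 'M[C]_#|{: J}|) :
  (forall k, represents (Y k) (Q k)) -> represents (stdpoly Y) (stdpoly Q).
Proof.
move=> HYQ; rewrite /stdpoly; elim/big_rec2: _ => [|s X X' _ HX].
  exact: represents0.
apply: representsD => //.
have HP : represents (\prod_(i < m) Y (s i)) (\prod_(i < m) Q (s i)).
  elim/big_rec2: _ => [|i T T' _ HT]; first exact: represents1.
  exact: representsM.
rewrite -signr_odd -[X in represents _ (X * _)]signr_odd.
case: (odd _); rewrite ?expr0 ?expr1 ?mulN1r ?mul1r //.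
exact: representsN.
Qed.

(** The representing matrices have size [n * N] over a commutative ring, so [stdpoly_matrix]
    annihilates their standard polynomial. *)
Lemma stdpoly_layer m (Y : 'I_m -> 'M[A]_n) x j :
  ((n * N) * (n * N) < m)%N -> (forall k, mx_in wordspan (Y k)) -> V x ->
  row_in V' ((x *: delta_mx 0 j) *m stdpoly Y).
Proof.
move=> mN BY /layer_fg[q Hx].
have /choice[Q HQ] k := represents_ex (BY k).
have [BS HS] := represents_stdpoly HQ.
have Q0 : stdpoly Q = 0.
  by apply: stdpoly_matrix; rewrite card_prod !card_ord.
set y := x - _ in Hx.
rewrite -(subrK (\sum_i ceval (q i) * layer_gen i) x) -/y scalerDl mulmxDl.
apply: row_inD.
  apply: row_in_mul => // k; rewrite !mxE; case: (k == j); rewrite ?andbF /=.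
    by rewrite mulr1.
  by rewrite mulr0; apply: gen0.
rewrite scaler_suml mulmx_suml; apply: row_in_sum => i.
rewrite -scalerA -scalemxAl; apply: row_in_ceval.
have := HS (enum_rank (j, i)); rewrite /row_gen enum_rankK /= Q0 big1 ?subr0 //.
by move=> b _; rewrite mxE raddf0 scale0r.
Qed.

End Rows.
End FixerLayer.

(** Each factor [stdpoly Y] moves the entries to layers of strictly larger sets, which have at most
    [#|Z|] elements. *)
Lemma stdpoly_nilpotent n m (Y : 'I_m -> 'M[A]_n) h (D : {set Z}) x j :
  ((n * size (words Z (#|Z| * (2 * p)))) *
   (n * size (words Z (#|Z| * (2 * p)))) < m)%N ->
  (forall k, mx_in wordspan (Y k)) -> (#|Z| < #|D| + h)%N ->
  layer (fun s => D \subset s) x ->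
  (x *: delta_mx 0 j : 'rV[A]_n) *m stdpoly Y ^+ h = 0.
Proof.
move=> mN BY; elim: h D x j => [|h IHh] D x j Dh Vx.
  by move: Dh; rewrite addn0 ltnNge max_card.
rewrite exprS mulmxA; have := stdpoly_layer j mN BY Vx.
set r := _ *m stdpoly Y => V'r.
have kill y k : layer (fun s => D \proper s) y ->
    (y *: delta_mx 0 k : 'rV[A]_n) *m stdpoly Y ^+ h = 0.
  elim=> {y} [_ [w Dw ->]||a y z _ IHy _ IHz|//].
  - apply: (IHh (fixer w)); last by apply: gen_in; exists w.
    by apply: leq_trans Dh _; rewrite addnS -addSn leq_add2r proper_card.
  - by rewrite scale0r mul0mx.
  - rewrite scalerDl mulmxDl IHz addr0 -[a *: y]mulr_algl -scalerA -scalemxAl.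
    by rewrite IHy scaler0.
rewrite [r]row_sum_delta mulmx_suml big1 // => k _; exact: kill.
Qed.

(** On the row [F] of generators, left multiplication by [a k] becomes right multiplication by a
    matrix over [wordspan], to which [stdpoly_nilpotent] applies. *)
Lemma shelf_stdpoly (fs : seq A) :
  (forall x, span (fun y => exists f w, f \in fs /\ y = f * ev w) x) ->
  exists m h, forall a : 'I_m -> A, stdpoly a ^+ h = 0.
Proof.
move=> fsA; pose n := size fs.
pose M := (n * size (words Z (#|Z| * (2 * p))))%N.
exists (M * M).+1, #|Z|.+1 => a.
have coef (x : A) : exists c : 'I_n -> A,
    (forall i, wordspan (c i)) /\ x = \sum_(i < n) fs`_i * c i.
  elim: (fsA x) =>
    {x} [_ [f [w [ffs ->]]]||k x y _ [c [Bc ->]] _ [d [Bd ->]]|//].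
  - have fi : (index f fs < n)%N by rewrite index_mem.
    exists (fun i => if i == Ordinal fi then ev w else 0); split.
      by move=> i; case: eqP => _; [apply: gen_in; exists w | exact: gen0].
    rewrite (bigD1 (Ordinal fi)) //= eqxx big1 => [|i /negPf->].
      by rewrite nth_index // addr0.
    by rewrite mulr0.
  - exists (fun=> 0); split=> [i|]; first exact: gen0.
    by rewrite big1 // => i _; rewrite mulr0.
  - exists (fun i => k *: c i + d i); split=> [i|].
      by apply: gen_lin; [exact: Bc | exact: Bd].
    rewrite scaler_sumr -big_split; apply: eq_bigr => i _ /=.
    by rewrite mulrDr scalerAr.
pose F : 'rV[A]_n := \row_i fs`_i.
pose rep x (Y : 'M[A]_n) := x *: F = F *m Y.
have /choice[Y HY] k : exists Y, mx_in wordspan Y /\ rep (a k) Y.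
  have /choice[c Hc] (j : 'I_n) := coef (a k * fs`_j).
  exists (\matrix_(i, j) c j i); split=> [i j|].
    by rewrite mxE; case: (Hc j).
  apply/rowP => j; rewrite !mxE; have [_ ->] := Hc j.
  by apply: eq_bigr => i _; rewrite !mxE.
have repM x y Yx Yy : rep x Yx -> rep y Yy -> rep (x * y) (Yx *m Yy).
  by rewrite /rep => Hx Hy; rewrite -scalerA Hy scalemxAl Hx mulmxA.
have rep1 : rep 1 1%:M by rewrite /rep scale1r mulmx1.
have repS : rep (stdpoly a) (stdpoly Y).
  rewrite /stdpoly; elim/big_rec2: _ => [|s y Yy _ Hy].
    by rewrite /rep scale0r mulmx0.
  rewrite /rep scalerDl mulmxDr Hy; congr (_ + _).
  have : rep (\prod_(i < (M * M).+1) a (s i)) (\prod_(i < (M * M).+1) Y (s i)).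
    elim/big_rec2: _ => // i z Yz _ Hz; apply: repM => //.
    by case: (HY (s i)).
  rewrite /rep -signr_odd -[in X in _ -> _ = X]signr_odd.
  case: (odd _) => E; rewrite ?expr1 ?expr0 ?mulN1r ?mul1r //.
  by rewrite scaleNr mulmxN E.
have repX : rep (stdpoly a ^+ #|Z|.+1) (stdpoly Y ^+ #|Z|.+1).
  elim: (#|Z|.+1) => [|h IHh]; first exact: rep1.
  by rewrite !exprS; apply: repM.
(* Each row is the image of a unit row, whose entry 1 is the value of the empty word and lies in the
   layer of the empty set. *)
have Y0 : stdpoly Y ^+ #|Z|.+1 = 0.
  apply/row_matrixP => j; rewrite rowE row0 -[delta_mx 0 j]scale1r.
  apply: (@stdpoly_nilpotent _ _ _ _ finset.set0).
  - exact: leqnn.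
  - by move=> k; case: (HY k).
  - by rewrite cards0 add0n.
  - by apply: gen_in; exists [::]; rewrite ?finset.sub0set // /ev big_nil.
move: repX; rewrite Y0 /rep mulmx0 => SF.
(* The element kills every generator from the left, hence also 1 expanded over the generators. *)
have [c [_ one]] := coef 1.
rewrite -[LHS]mulr1 one mulr_sumr big1 // => i _.
have /rowP/(_ i) := SF; rewrite !mxE mulrA => ->.
by rewrite mul0r.
Qed.

Lemma shelf_growth (fs : seq A) :
  (forall x, span (fun y => exists f w, f \in fs /\ y = f * ev w) x) ->
  forall s : seq A, exists C, forall n, (growth s n <= C * n.+1 ^ #|Z|)%N.
Proof.
move=> fsA s.
pose W n := span (fun y => exists f w,
  [/\ f \in fs, (size w <= n)%N & y = f * ev w]).
have sW n : submod rm (fun=> False) (W n) by apply: gen_submod.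
have mW m n x : (m <= n)%N -> W m x -> W n x.
  move=> mn; apply: gen_mono => // y [f [w [ffs wm ->]]]; exists f, w.
  by split=> //; apply: leq_trans mn.
have W_ex x : exists n, W n x.
  elim: (fsA x) => {x} [_ [f [w [ffs ->]]]||a x y _ [m Wx] _ [n Wy]|//].
  - by exists (size w); apply: gen_in; exists f, w.
  - by exists 0%N; apply: gen0.
  - exists (maxn m n); apply: gen_lin.
      exact: mW (leq_maxl _ _) Wx.
    exact: mW (leq_maxr _ _) Wy.
have W_list (l : seq A) : exists L, forall x, x \in l -> W L x.
  elim: l => [|x l [L HL]]; first by exists 0%N.
  have [n Wx] := W_ex x; exists (maxn n L) => y.
  rewrite inE => /predU1P[->|/HL]; first exact: mW (leq_maxl _ _) Wx.
  exact: mW (leq_maxr _ _).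
(* [L] bounds the degree of 1 and of all products [a * f], so each left factor from [s] raises the
   degree by at most [L]. *)
have [L HL] := W_list (1 :: [seq a * f | a <- s, f <- fs]).
have W_mul m a x : a \in s -> W m x -> W (m + L)%N (a * x).
  move=> sa; elim=> {x} [_ [f [w [ffs wm ->]]]||c x y _ IHx _ IHy|//].
  - rewrite mulrA; have : W L (a * f).
      by apply: HL; rewrite inE allpairs_f ?orbT.
    elim=> {f ffs} [_ [f [v [ffs vL ->]]]||c x y _ IHx _ IHy|//].
    + apply: gen_in; exists f, (v ++ w); split=> //.
        by rewrite size_cat addnC leq_add.
      by rewrite ev_cat mulrA.
    + by rewrite mul0r; apply: gen0.
    + by rewrite mulrDl -scalerAl; apply: gen_lin.
  - by rewrite mulr0; apply: gen0.
  - by rewrite mulrDr -scalerAr; apply: gen_lin.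
have W_prods i x : x \in prods s i -> W (i.+1 * L)%N x.
  elim: i x => [|i IHi] x /=.
    by rewrite inE => /eqP->; rewrite mul1n; apply: HL; rewrite mem_head.
  case/allpairsP=> -[a b] /= [sa bi ->].
  by rewrite mulSn addnC; apply: W_mul => //; apply: IHi.
(* The factor in [L] comes from [(n.+1 * L).+1 <= L.+1 * n.+1]. *)
exists (size fs * (size (words Z (#|Z| * (2 * p))) * L.+1 ^ #|Z|))%N => n.
pose l := [seq f * y | f <- fs, y <- normal_words (n.+1 * L)].
apply: (@leq_trans (size l)).
  apply: (@span_dim_le _ _ _ rm) => x /flattenP[r /mapP[i + ->] xi].
  rewrite mem_iota add0n ltnS => /= iN.
  have : W (n.+1 * L)%N x.
    by apply: mW (W_prods i x xi); rewrite leq_mul2r ltnS iN orbT.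
  apply: gen_mono => // _ [f [w [ffs wn ->]]].
  by apply: allpairs_f => //; apply: mem_normal_words.
rewrite size_allpairs size_normal_words -!mulnA !leq_mul2l; apply/orP; right.
apply/orP; right; rewrite -expnMn; have [->|Z0] := posnP #|Z|.
  by rewrite !expn0.
by rewrite leq_exp2r // mulnS mulnC addnC; lia.
Qed.

End Shelf.

(** * The structure monoid *)

Section Degenerate.
Context (X : finType) (lam : X -> X -> X) (rho : X -> X).
Hypothesis lamM : forall x y z,
  lam x (lam y z) = lam (lam x y) (lam (rho x) z).
Hypothesis rhoM : forall x y, rho (lam x y) = lam (rho x) (rho y).

Implicit Types (u v w : seq X) (x y : X).

(** The word that appears on the left when [x] is moved through [w]: at each letter passed, [x]
    turns into its image under [rho]. *)
Fixpoint lam1 x w : seq X :=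
  if w is y :: w' then lam x y :: lam1 (rho x) w' else [::].

Definition lamw u w : seq X := foldr lam1 w u.

Lemma size_lam1 x w : size (lam1 x w) = size w.
Proof. by elim: w x => //= y w IHw x; rewrite IHw. Qed.

Lemma size_lamw u w : size (lamw u w) = size w.
Proof. by elim: u => //= x u IHu; rewrite size_lam1. Qed.

Lemma lam1_lam1 x y w :
  lam1 x (lam1 y w) = lam1 (lam x y) (lam1 (rho x) w).
Proof. by elim: w x y => //= z w IHw x y; rewrite lamM IHw rhoM. Qed.

Lemma lam1_lamw x u w :
  lam1 x (lamw u w) = lamw (lam1 x u) (lam1 (iter (size u) rho x) w).
Proof.
by elim: u x => //= y u IHu x; rewrite lam1_lam1 IHu -iterSr.
Qed.

Lemma lamw_lamw u v w :
  lamw u (lamw v w) =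
  lamw (lamw u v) (lamw (map (iter (size v) rho) u) w).
Proof.
by elim: u => //= x u IHu; rewrite IHu lam1_lamw size_lamw.
Qed.

Lemma map_rho_lam1 n x w :
  map (iter n rho) (lam1 x w) = lam1 (iter n rho x) (map (iter n rho) w).
Proof.
have rhoMn k y z : iter k rho (lam y z) = lam (iter k rho y) (iter k rho z).
  by elim: k => //= k ->; rewrite rhoM.
by elim: w x => //= y w IHw x; rewrite IHw rhoMn -iterSr.
Qed.

Lemma map_rho_lamw n u w :
  map (iter n rho) (lamw u w) =
  lamw (map (iter n rho) u) (map (iter n rho) w).
Proof. by elim: u => //= x u IHu; rewrite map_rho_lam1 IHu. Qed.

Lemma lam1_inj x : (forall y, injective (lam y)) -> injective (lam1 x).
Proof.
move=> lam_inj w w'; elim: w w' x => [|y w IHw] [|y' w'] x //=.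
by case=> /lam_inj-> /IHw->.
Qed.

Lemma lamw_inj u : (forall y, injective (lam y)) -> injective (lamw u).
Proof.
move=> lam_inj; elim: u => //= x u IHu w w'.
by move=> /lam1_inj-/(_ lam_inj)/IHu.
Qed.

Context (K : fieldType).
Let r : X * X -> X * X := fun q => (lam q.1 q.2, rho q.1).
Local Notation M := (struct_monoid r).
Local Notation A := (monoid_algebra K M).

Definition mon u : A := << struct_pi r u >>.

Lemma mon_cat u v : mon (u ++ v) = mon u * mon v.
Proof.
rewrite /mon [RHS]malgM_def fgmulUU mulr1; congr << _ >>.
by rewrite -struct_mulE.
Qed.

Lemma mon_nil : mon [::] = 1.
Proof. by []. Qed.

Lemma mon_step x y : mon [:: x; y] = mon [:: lam x y; rho x].
Proof.
congr << _ >>; apply/struct_piP.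
exact/rst_step/(@StructStep X r [::] [::] x y).
Qed.

Lemma mon_pull1 x w :
  mon (x :: w) = mon (rcons (lam1 x w) (iter (size w) rho x)).
Proof.
elim: w x => [|y w IHw] x //=.
rewrite -cat1s -[y :: w]cat1s catA mon_cat mon_step -mon_cat -cat1s -catA.
by rewrite mon_cat /= IHw -mon_cat -iterSr.
Qed.

Lemma mon_pull u w :
  mon (u ++ w) = mon (lamw u w ++ map (iter (size w) rho) u).
Proof.
elim: u => [|x u IHu] /=; first by rewrite cats0.
rewrite -cat1s mon_cat IHu -mon_cat catA mon_cat cat1s mon_pull1 -mon_cat.
by rewrite size_lamw cat_rcons.
Qed.

(** * The shelf of blocks *)

Let N := #|X| `!.
Let e := iter N rho.

Let N_gt0 : (0 < N)%N.
Proof. exact: fact_gt0. Qed.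

Let e_idem x : e (e x) = e x.
Proof. exact: iter_fact_idem. Qed.

Let map_e_idem w : map e (map e w) = map e w.
Proof. by rewrite -map_comp; apply: eq_map => x /=. Qed.

Fact lamw_tupleP (b c : N.-tuple X) : size (lamw (map e b) c) == N.
Proof. by rewrite size_lamw size_tuple. Qed.

(* Blocks of length N form a shelf, since moving a block across another one
   applies the idempotent rho^N to its letters. *)
Definition block_tri (b c : N.-tuple X) : N.-tuple X := Tuple (lamw_tupleP b c).

(** Applying [e] in the value lets all tuples serve as letters, without restricting to the image of
    [e]. *)
Definition block_mon (b : N.-tuple X) : A := mon (map e b).

Lemma block_triA b c d :
  block_tri b (block_tri c d) = block_tri (block_tri b c) (block_tri b d).
Proof.
apply: val_inj => /=; rewrite lamw_lamw size_map size_tuple map_rho_lamw.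
by rewrite -/e !map_e_idem.
Qed.

Lemma block_monM b c :
  block_mon b * block_mon c = block_mon (block_tri b c) * block_mon b.
Proof.
rewrite /block_mon -!mon_cat mon_pull size_map size_tuple map_rho_lamw -/e.
by rewrite !map_e_idem.
Qed.

(** The first factor makes the iterates of block translations idempotent; the factor [N] makes those
    of permutations of [X] trivial. *)
Let P := (#|{: N.-tuple X}| `! * N)%N.

Let P_gt0 : (0 < P)%N.
Proof. by rewrite muln_gt0 fact_gt0. Qed.

Let block_idem b c :
  iter P (block_tri b) (iter P (block_tri b) c) = iter P (block_tri b) c.
Proof. by apply: iter_fact_idem => //; apply: dvdn_mulr. Qed.

Let prefixes : seq A := map mon (words X (N + N)).

Lemma blocks_ev w : map e w = w -> (N %| size w)%N ->
  exists bs, mon w = ev block_mon bs.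
Proof.
have [n] := ubnP (size w); elim: n w => // n IHn w; rewrite ltnS => wn we Nw.
have [/eqP|w0] := posnP (size w).
  by rewrite size_eq0 => /eqP->; exists [::]; rewrite /ev big_nil.
have Nlew : (N <= size w)%N by apply: dvdn_leq.
have st : size (take N w) == N by rewrite size_takel.
have [|||bs Hbs] := IHn (drop N w).
- rewrite size_drop ltn_subLR // (leq_ltn_trans wn) //.
  by rewrite -[X in (X < _)%N]add0n ltn_add2r.
- by rewrite map_drop we.
- by rewrite size_drop dvdn_subr.
exists (Tuple st :: bs).
rewrite -{1}(cat_take_drop N w) mon_cat Hbs /ev big_cons; congr (_ * _).
by rewrite /block_mon /= map_take we.
Qed.

Local Notation rm := (fun a : A => rmul a : {linear A -> A}).

Lemma mon_prefix_blocks w :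
  exists f bs, f \in words X (N + N) /\ mon w = mon f * ev block_mon bs.
Proof.
have [sw|sw] := leqP (size w) (N + N).
  by exists w, [::]; rewrite mem_words sw /ev big_nil mulr1.
(* A suffix [b] of this length leaves a word [a] of length divisible by [N]. Moving [a] to the right
   of [b] applies [rho] at least [N] times, so its letters become fixed by [e]. *)
pose s := (N + size w %% N)%N.
have ss : (s <= N + N)%N by rewrite leq_add2l ltnW // ltn_mod.
have sle : (s <= size w)%N by apply: leq_trans ss (ltnW sw).
pose a := take (size w - s) w; pose b := drop (size w - s) w.
have sb : size b = s by rewrite size_drop subKn.
have sa : size a = (size w - s)%N by rewrite size_takel // leq_subr.
have [||bs Hbs] := @blocks_ev (map (iter s rho) a).
- rewrite -map_comp; apply: eq_map => x /=.
  by rewrite /s addnC iterD -/e -iterD addnC iterD -/e e_idem.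
- rewrite size_map sa /s addnC subnDA dvdn_sub //.
  by rewrite {1}(divn_eq (size w) N) addnK dvdn_mull.
exists (lamw a b), bs; rewrite mem_words size_lamw sb ss; split=> //.
by rewrite -{1}(cat_take_drop (size w - s) w) -/a -/b mon_pull mon_cat sb Hbs.
Qed.

Lemma blocks_span (z : A) : gen rm (fun=> False)
  (fun a => exists f bs, f \in prefixes /\ a = f * ev block_mon bs) z.
Proof.
rewrite (monalgE (z : {malg K[M]})).
apply: (submod_sum (th := rm) _ (gen_submod _ _ _)) => k _.
have -> : << z@_k *g k >> = z@_k *: (<< k >> : A).
  by apply/malgP => k'; rewrite [in RHS]mcoeffZ !mcoeffU mulrnAr mulr1.
apply: (submodZ _ (gen_submod rm _ _)); apply: gen_in.
elim/(@struct_piS X r): k => u; have [f [bs [fw E]]] := mon_prefix_blocks u.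
by exists (mon f), bs; split; [exact: map_f | exact: E].
Qed.

(** * Transfer to the monoid algebra *)

Lemma degenerate_right_noetherian : right_noetherian A.
Proof.
move=> U HU US.
have [n|n a|Nn HN] := @shelf_right_noeth K A _ _ _ P block_triA block_monM P_gt0
    block_idem prefixes U.
- have [U0 UD UM] := HU n; split; last by move=> a _; apply: blocks_span.
  split=> // [c a b Ua Ub|a b _ Ua]; last exact: UM.
  by apply: UD => //; rewrite -mulr_algr; apply: UM.
- exact: US.
exists Nn => n Nnn; apply/seteqP; split=> a; first exact: HN.
exact: (chain_mono US).
Qed.

Lemma degenerate_PI : PI_algebra A.
Proof.
have [m [h H]] :=
  shelf_stdpoly block_triA block_monM P_gt0 block_idem blocks_span.
exact: PI_of_stdpoly H.
Qed.

Lemma degenerate_GKdim (R : realType) : (GKdim R A < +oo)%E.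
Proof.
apply: GKdim_lty.
exact: (shelf_growth block_triA block_monM P_gt0 block_idem blocks_span).
Qed.

(** Moving the block [d] through a letter [y] turns [y] into [h y] and [d] into [c]; after [P]
    blocks the letter is [y] again, as the permutation [h] has order dividing [P]. *)
Lemma block_powC (lam_inj : forall x, injective (lam x)) u b :
  exists c, mon u * block_mon b ^+ P = block_mon c ^+ P * mon u.
Proof.
elim: u b => [|x u IHu] b; first by exists b; rewrite mon_nil mulr1 mul1r.
have [c Hc] := IHu b.
(* With the exponent [N.-1], one further [rho] on the letters of [map e d] gives [map e c]. *)
pose d : N.-tuple X := map_tuple (iter N.-1 rho) c.
exists d; rewrite -cat1s mon_cat -mulrA Hc !mulrA; congr (_ * _).
pose h (y : X) := foldr lam y (map e d).
have hE y : lamw (map e d) [:: y] = [:: h y].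
  by rewrite /h /lamw; elim: (map e d) => //= z w ->.
have move1 y : block_mon d * mon [:: y] = mon [:: h y] * block_mon c.
  rewrite /block_mon -!mon_cat mon_pull hE; congr (mon (_ ++ _)).
  rewrite /= -!map_comp; apply: eq_map => z /=.
  rewrite -[rho _]/(iter 1 rho _) /e -!iterD -addnA addnCA add1n prednK //.
  by rewrite iterD; apply: e_idem.
have h_inj : injective h.
  by rewrite /h; elim: (map e d) => //= z w IHw y y' /lam_inj/IHw.
have moveX k y : block_mon d ^+ k * mon [:: y] =
    mon [:: iter k h y] * block_mon c ^+ k.
  elim: k => [|k IHk]; first by rewrite mul1r mulr1.
  by rewrite !exprS -mulrA IHk !mulrA move1.
rewrite moveX iter_inj_id //.
by apply: dvdn_mull.
Qed.

Lemma degenerate_left_noetherian : (forall x, injective (lam x)) ->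
  left_noetherian A.
Proof.
move=> lam_inj U HU US.
have tri_inj b : injective (block_tri b).
  by move=> c d /(congr1 val) /lamw_inj-/(_ lam_inj)/val_inj.
have [|f b /mapP[u _ ->]|n|n a|Nn HN] := @shelf_left_noeth K A _ _ _ P
    block_triA block_monM P_gt0 block_idem prefixes _ _ blocks_span U.
- by move=> b c; apply: iter_inj_id (tri_inj b) P_gt0 _; apply: dvdn_mulr.
- exact: block_powC.
- have [U0 UD UM] := HU n; split=> //.
  split=> // [c a b Ua Ub|a b _ Ub]; last exact: UM.
  by apply: UD => //; rewrite -mulr_algl; apply: UM.
- exact: US.
exists Nn => n Nnn; apply/seteqP; split=> a; first exact: HN.
exact: (chain_mono US).
Qed.

End Degenerate.

Theorem proposition6 (X : finType) (lam : X -> X -> X) (rho : X -> X)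
    (K : fieldType) (R : realType) :
  let r : X * X -> X * X := fun p => (lam p.1 p.2, rho p.1) in
  let A : algType K := monoid_algebra K (struct_monoid r) in
  yang_baxter r ->
  [/\ right_noetherian A, PI_algebra A & (GKdim R A < +oo)%E] /\
  (left_nondegenerate r -> left_noetherian A).
Proof.
move=> r A YB.
(* The first and second components of the braid relation yield the two identities. *)
have lamM x y z : lam x (lam y z) = lam (lam x y) (lam (rho x) z).
  by have [] := YB (x, y, z).
have rhoM x y : rho (lam x y) = lam (rho x) (rho y).
  by have [] := YB (x, y, x).
split=> [|nondeg].
  split.
  - exact: degenerate_right_noetherian.
  - exact: degenerate_PI.
  - exact: degenerate_GKdim.
by apply: degenerate_left_noetherian => // x; apply: bij_inj (nondeg x).
Qed.
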